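(* Let $f$ be a function of subexponential growth. Let $G$ be an infinite connected graph with $|B_r(x)|\le f(r)$ for every $x\in V(G)$ and $r\ge1$, having uniform patch frequency (UPF), and let $\{G_n\}_{n=1}^\infty$ be a Følner sequence in $G$. Then (a) $\lim_{n\to\infty}\frac{I(G_n)}{|V(G_n)|}$ exists; (b) $\lim_{n\to\infty}\frac{M(G_n)}{|V(G_n)|}$ exists; (c) $\lim_{n\to\infty}\frac{\log \pi^I_{G_n}(\lambda)}{|V(G_n)|}$ exists for all $0<\lambda<\infty$; (d) $\lim_{n\to\infty}\frac{\log \pi^M_{G_n}(\lambda)}{|V(G_n)|}$ exists for all $0<\lambda<\infty$.
   Context: A function $f:\mathbb{N}\to\mathbb{N}$ has subexponential growth if for every $\delta>0$ there is $C_\delta>0$ such that $f(n)\le C_\delta(1+\delta)^n$ for all $n\ge1$. $B_r(x)$ is the ball of radius $r$ around $x$ (the vertices at graph distance at most $r$ from $x$ with the induced graph structure, rooted at $x$). Følner sequence in $G$: a sequence of finite induced subgraphs $\{F_n\}_{n=1}^\infty$ of $G$ with $\bigcup_{n=1}^\infty F_n=G$ and $\lim_{n\to\infty}|\partial F_n|/|V(F_n)|=0$, where $\partial F_n$ is the set of $p\in V(F_n)$ for which there is $q\notin V(F_n)$ with $(p,q)\in E(G)$. Weak convergence: let $d$ bound the vertex degrees. For $r\ge1$, $U^{r,d}$ is the finite set of rooted isomorphism classes of finite simple connected rooted graphs of maximum degree at most $d$ in which every vertex is at distance at most $r$ from the root; for a finite graph $F$ and $\alpha\in U^{r,d}$,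 $p_F(\alpha)$ is the proportion of vertices $x$ of $F$ whose ball $B_r(x)$ in $F$ is rooted isomorphic to $\alpha$. A sequence of finite graphs $\{F_n\}$ with degree bound $d$ and $|V(F_n)|\to\infty$ is weakly convergent if $\lim_n p_{F_n}(\alpha)$ exists for every $r\ge 1$ and $\alpha\in U^{r,d}$. An infinite graph $G$ of subexponential growth has uniform patch frequency (UPF) if all of its Følner subgraph sequences are weakly convergent. For a finite graph $H$: $I(H)$ is the maximal size of an independent subset of $V(H)$; $M(H)$ is the maximal size of a matching in $E(H)$; $\pi_H^I(\lambda)=\sum_{S}\lambda^{|S|}$, the sum over all independent subsets $S\subset V(H)$; $\pi_H^M(\lambda)=\sum_T\lambda^{|T|}$, the sum over all matchings $T\subset E(H)$. (For $\lambda=1$ the limits in (c) and (d) are called the associated entropies.) *)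

(* Defs.v *)
From HB Require Import structures.
From mathcomp Require Import all_boot all_order all_algebra.
From mathcomp Require Import finmap.
From mathcomp Require Import all_classical all_reals all_analysis.
Set Implicit Arguments.
Unset Strict Implicit.
Unset Printing Implicit Defensive.
Import Order.TTheory GRing.Theory Num.Theory.
Import numFieldNormedType.Exports.
Local Open Scope ring_scope.

Record sgraph (V : Type) := SGraph {
  adj :> rel V;
  adj_sym : symmetric adj;
  adj_irr : irreflexive adj }.

Section Induced.
Variables (V : Type) (P : pred V) (S : subType P) (G : sgraph V).

Let iadj : rel S := [rel x y | G (val x) (val y)].

Let iadj_sym : symmetric iadj.
Proof. by move=> x y; apply: adj_sym. Qed.

Let iadj_irr : irreflexive iadj.
Proof. by move=> x; apply: adj_irr. Qed.

Definition induced : sgraph S := SGraph iadj_sym iadj_irr.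
End Induced.
Arguments induced {V P} S G.

Definition induced_fset (V : choiceType) (G : sgraph V) (F : {fset V}) :
  sgraph F := induced F G.

Section FiniteGraph.
Variables (T : finType) (H : sgraph T).

Definition independent (S : {set T}) : bool :=
  [forall x in S, forall y in S, ~~ H x y].

Definition edges : {set {set T}} :=
  [set [set u.1; u.2] | u in [pred u : T * T | H u.1 u.2]].

Definition matching (M : {set {set T}}) : bool :=
  (M \subset edges) && finset.trivIset M.

Definition indep_number : nat := \max_(S : {set T} | independent S) #|S|.

Definition matching_number : nat := \max_(M : {set {set T}} | matching M) #|M|.

Definition indep_poly (R : realType) (lambda : R) : R :=
  \sum_(S : {set T} | independent S) lambda ^+ #|S|.

Definition matching_poly (R : realType) (lambda : R) : R :=
  \sum_(M : {set {set T}} | matching M) lambda ^+ #|M|.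
End FiniteGraph.

Local Open Scope classical_set_scope.
Local Open Scope card_scope.

Section Graph.
Variables (V : Type) (G : sgraph V).

Definition dist_le (r : nat) (x y : V) : Prop :=
  exists p : seq V, [/\ path G x p, last x p = y & (size p <= r)%N].

Definition gball (r : nat) (x : V) : set V := [set y | dist_le r x y].

Definition gconnected : Prop := forall x y, exists r, dist_le r x y.

Definition max_degree_le (d : nat) : Prop :=
  forall x, [set y | G x y] #<= `I_d.

Definition growth_le (f : nat -> nat) : Prop :=
  forall r x, (1 <= r)%N -> gball r x #<= `I_(f r).
End Graph.

Definition rooted_iso (V W : Type) (G : sgraph V) (x : V)
    (H : sgraph W) (y : W) : Prop :=
  exists h : V -> W,
    [/\ bijective h, h x = y & forall u v, H (h u) (h v) = G u v].

Lemma gball_center (V : Type) (G : sgraph V) r (x : V) : x \in gball G r x.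
Proof. by rewrite inE; exists [::]. Qed.

Definition ball_root (V : Type) (G : sgraph V) r (x : V) : gball G r x :=
  exist _ x (gball_center G r x).

Definition ball_graph (V : Type) (G : sgraph V) r (x : V) :
  sgraph (gball G r x) := induced (gball G r x) G.

(* (A, a) represents an element of U^{r,d}. The isomorphism class itself is not
   formed: patch_freq below depends only on the class of (A, a). *)
Definition is_patch (r d : nat) (K : finType) (A : sgraph K) (a : K) : Prop :=
  [/\ gconnected A, max_degree_le A d & forall y, dist_le A r a y].

Definition patch_freq (R : realType) (T : finType) (H : sgraph T)
    (r : nat) (K : finType) (A : sgraph K) (a : K) : R :=
  #|[pred x : T | `[< rooted_iso (ball_graph H r x) (ball_root H r x) A a >]]|%:R
  / #|T|%:R.

Definition weakly_convergent (R : realType) (d : nat) (T : nat -> finType)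
    (H : forall n, sgraph (T n)) : Prop :=
  [/\ forall n, max_degree_le (H n) d,
      #|T n| @[n --> \oo] --> \oo &
      forall (r : nat) (K : finType) (A : sgraph K) (a : K),
        (1 <= r)%N -> is_patch r d A a ->
        cvgn (fun n => patch_freq R (H n) r A a)].

Definition boundary (V : choiceType) (G : sgraph V) (F : {fset V}) : {fset V} :=
  [fset p in F | `[< exists q, q \notin F /\ G p q >]]%fset.

(* The members are nonempty, so that the ratios below are genuine quotients.
   The union of the induced subgraphs is G as a graph: every vertex and every
   edge of G lies in one of them. The sets are not required to be nested. *)
Definition folner (R : realType) (V : choiceType) (G : sgraph V)
    (F : nat -> {fset V}) : Prop :=
  [/\ forall n, F n != fset0,
      forall x, exists n, x \in F n,
      forall x y, G x y -> exists n, x \in F n /\ y \in F n &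
      (#|` boundary G (F n)|%:R / #|` F n|%:R : R) @[n --> \oo] --> (0 : R)].

(* The choice of the degree bound d is immaterial: a patch with a vertex of
   degree larger than the degrees in G has frequency 0. *)
Definition UPF (R : realType) (V : choiceType) (G : sgraph V) : Prop :=
  exists2 d, max_degree_le G d &
    forall F : nat -> {fset V}, folner R G F ->
      weakly_convergent R d (fun n => induced_fset G (F n)).

Definition subexponential (R : realType) (f : nat -> nat) : Prop :=
  forall delta : R, 0 < delta -> exists2 C : R, 0 < C &
    forall n, (1 <= n)%N -> (f n)%:R <= C * (1 + delta) ^+ n.

(* Main.v *)
(* Each of the four parameters is the value at [V(F)] of a function [h] on vertex
   sets which vanishes on the empty set, grows by a bounded amount when a vertex
   is added, is additive on sets with no edge between them, and is invariant
   under isomorphism.  It is enough to approximate [h(V(F))], uniformly over the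
   finite graphs [F] of growth at most [f] and up to an error [e |V(F)|], by a
   sum over the vertices [x] of quantities depending only on the ball of a fixed
   radius around [x]: weak convergence makes the averages of such sums converge.

   Let [w x z = q ^ min(d(x,z),r) - q ^ r] with [q] close to 1 and [q ^ r f(r)]
   small, and let [W z] be the sum over [x] of [w x z].  The functions
   [z |-> w x z / W z] are a partition of unity made of local functions that vary
   slowly.  The local quantity is the layer-cake sum of [h] over the superlevel
   sets of the function attached to [x].  To see that these sums add up to about
   [N h(V(F))], where [N] is the number of layers, remove a small set [Z] of
   vertices so that the rest splits into pieces of bounded radius without edges
   between them (ball growing).  Then [h] is almost additive over the pieces, and
   few superlevel sets cut a given piece because the functions vary slowly.
   Both the choice of [q] and [r] and the existence of [Z] rely on the
   subexponential growth. *)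
Require Import Defs.
From HB Require Import structures.
From mathcomp Require Import all_boot all_order all_algebra.
From mathcomp Require Import finmap.
From mathcomp Require Import all_classical all_reals all_analysis.
From mathcomp Require Import ring lra zify.
Set Implicit Arguments.
Unset Strict Implicit.
Unset Printing Implicit Defensive.
Import Order.TTheory GRing.Theory Num.Theory.
Import numFieldNormedType.Exports.
Local Open Scope ring_scope.

(** * Distances and ball growing *)

Section Dist.
Variables (V : Type) (H : sgraph V).

Lemma dist_le_refl r x : dist_le H r x x.
Proof. by exists [::]. Qed.

Lemma dist_le_mono r s x y : (r <= s)%N -> dist_le H r x y -> dist_le H s x y.
Proof. by move=> rs [p [pp lp sp]]; exists p; split=> //; apply: leq_trans rs. Qed.

Lemma dist_le_trans r s x y z :
  dist_le H r x y -> dist_le H s y z -> dist_le H (r + s) x z.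
Proof.
move=> [p [pp lp sp]] [q [pq lq sq]]; exists (p ++ q).
by rewrite cat_path last_cat size_cat lp pp pq leq_add.
Qed.

Lemma dist_le1 x y : H x y -> dist_le H 1 x y.
Proof. by move=> xy; exists [:: y]; rewrite /= xy. Qed.

Lemma dist_le_sym r x y : dist_le H r x y -> dist_le H r y x.
Proof.
move=> [p [pp <- sp]]; exists (rev (belast x p)); split.
- by rewrite rev_path; under eq_path do rewrite adj_sym.
- by case: p {pp sp} => //= a p; rewrite rev_cons last_rcons.
- by rewrite size_rev size_belast.
Qed.
End Dist.

Lemma dist_le_morph (V W : Type) (A : sgraph V) (H : sgraph W) (e : V -> W) k u w :
  (forall x y, A x y -> H (e x) (e y)) -> dist_le A k u w -> dist_le H k (e u) (e w).
Proof.
move=> eadj [p [pp <- sp]]; exists (map e p); split.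
- by elim: p u pp {sp} => //= v p IH u /andP[/eadj-> /IH].
- by rewrite last_map.
- by rewrite size_map.
Qed.

(** For [delta = (1/q - 1)/2] the product [(1 + delta) q] equals [(1 + q)/2 < 1], so [f r q^r] is at
    most a constant times a geometric sequence tending to 0. *)
Lemma subexponential_decay (R : realType) (f : nat -> nat) (q e : R) :
  subexponential R f -> 0 < q < 1 -> 0 < e ->
  exists2 r : nat, (1 <= r)%N & (f r)%:R * q ^+ r < e.
Proof.
move=> hf /andP[q0 q1] e0.
have d0 : 0 < (q^-1 - 1) / 2 by rewrite divr_gt0 // subr_gt0 invf_gt1.
have [C C0 hC] := hf _ d0.
set s : R := (1 + q) / 2.
have sE : (1 + (q^-1 - 1) / 2) * q = s by rewrite /s; field; lra.
have s1 : `|s| < 1 by rewrite /s ger0_norm; lra.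
have /cvgrPdist_lt/(_ (e / C)) := cvg_expr s1.
have eC : 0 < e / C by rewrite divr_gt0.
move=> /(_ eC) [k _ hk]; exists k.+1 => //.
have := hk k.+1 (leqnSn k); rewrite sub0r normrN => /(le_lt_trans (ler_norm _)).
rewrite ltr_pdivlMr // => /(le_lt_trans _); apply.
rewrite -sE exprMn [X in _ <= X]mulrC mulrA ler_wpM2r ?hC//.
by rewrite exprn_ge0 // ltW.
Qed.

Lemma card_set_le_I (T : finType) (P : set T) n :
  (P #<= `I_n)%card -> (#|[set x | `[< P x >]]| <= n)%N.
Proof.
move=> Pn; apply: leq_trans (geq_card_fset_set Pn).
rewrite cardE; apply: uniq_leq_size; first exact: enum_uniq.
move=> x; rewrite mem_enum inE => /asboolP Px.
by rewrite in_fset_set ?mem_set//; apply/finite_set_leP; exists n.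
Qed.

Section Finite.
Variables (T : finType) (H : sgraph T).

Definition fball r x : {set T} := [set y | `[< dist_le H r x y >]].

Lemma fballP r x y : reflect (dist_le H r x y) (y \in fball r x).
Proof. by rewrite inE; apply: asboolP. Qed.

Lemma card_fball f r x : growth_le H f -> (1 <= r)%N -> (#|fball r x| <= f r)%N.
Proof. by move=> hf r1; apply/card_set_le_I/hf. Qed.

Lemma fballC r x y : (y \in fball r x) = (x \in fball r y).
Proof. by apply/fballP/fballP; apply: dist_le_sym. Qed.

(** For [x] in [U], the ball of radius [k] around [x] in the subgraph induced on [U]; the carving
    below works in what earlier balls have left over. *)
Fixpoint grow (U : {set T}) (x : T) (k : nat) : {set T} :=
  if k is k'.+1 then
    grow U x k' :|: [set y in U | [exists z in grow U x k', H z y]]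
  else [set x].

Lemma grow_fball U x k : grow U x k \subset fball k x.
Proof.
elim: k => [|k IH]; apply/fintype.subsetP => y.
  by rewrite inE => /eqP->; apply/fballP/dist_le_refl.
rewrite /= finset.in_setU => /orP[/(fintype.subsetP IH)/fballP yk|].
  by apply/fballP; exact: dist_le_mono (leqnSn k) yk.
rewrite inE => /andP[_ /exists_inP[z /(fintype.subsetP IH)/fballP xz zy]].
by apply/fballP; rewrite -addn1; exact: dist_le_trans xz (dist_le1 zy).
Qed.

Lemma grow_sub (U : {set T}) x k : x \in U -> grow U x k \subset U.
Proof.
move=> xU; elim: k => [|k IH] /=; first by rewrite finset.sub1set.
by rewrite finset.subUset IH; apply/fintype.subsetP => y; rewrite inE => /andP[].
Qed.

Lemma grow_root (U : {set T}) x k : x \in grow U x k.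
Proof. by elim: k => [|k IH]; rewrite !inE ?eqxx// IH. Qed.

Variable R : realType.

(* Otherwise the [r]-th ball would have more than [f r] vertices. *)
Lemma small_sphere (f : nat -> nat) (e : R) r U x :
  growth_le H f -> (1 <= r)%N -> 0 < e -> (f r)%:R < (1 + e) ^+ r ->
  exists2 k, (k < r)%N &
    (#|grow U x k.+1 :\: grow U x k|)%:R <= e * #|grow U x k|%:R.
Proof.
move=> hf r1 e0 fr; apply: contrapT => no.
suff /(_ r (leqnn r)) : forall k, (k <= r)%N -> (1 + e) ^+ k <= #|grow U x k|%:R.
  apply/negP; rewrite -ltNge; apply: le_lt_trans fr; rewrite ler_nat.
  exact: leq_trans (subset_leq_card (grow_fball U x r)) (card_fball _ _ _).
elim=> [|k IH] kr; first by rewrite expr0 cards1.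
rewrite exprS; apply: (@le_trans _ _ ((1 + e) * #|grow U x k|%:R)).
  by rewrite ler_wpM2l ?IH 1?ltnW//; lra.
rewrite leNgt; apply/negP => lt; apply: no; exists k => //.
have sub : grow U x k \subset grow U x k.+1 by apply: finset.subsetUl.
rewrite cardsD (finset.setIidPr sub) natrB ?subset_leq_card//.
by move: lt; rewrite mulrDl mul1r; lra.
Qed.

(** Balls with a small outer sphere are removed one after another from what is left. Each ball
    becomes a piece, whose centre [c] records, and its sphere goes into [Z]. The spheres are charged
    to disjoint balls, which bounds [Z]. *)
Lemma carving (f : nat -> nat) (e : R) r :
  growth_le H f -> (1 <= r)%N -> 0 < e -> (f r)%:R < (1 + e) ^+ r ->
  exists (Z : {set T}) (c : T -> T),
    [/\ #|Z|%:R <= e * #|T|%:R,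
        forall z, z \notin Z -> dist_le H r (c z) z &
        forall y z, y \notin Z -> z \notin Z -> H y z -> c y = c z].
Proof.
move=> hf r1 e0 fr.
(* The claim is generalised to the set [U] of remaining vertices, for a strong induction on its
   size. *)
suff: forall U : {set T}, exists (Z : {set T}) (c : T -> T),
    [/\ Z \subset U, #|Z|%:R <= e * #|U|%:R,
        forall z, z \in U :\: Z -> dist_le H r (c z) z &
        forall y z, y \in U :\: Z -> z \in U :\: Z -> H y z -> c y = c z].
  move=> /(_ finset.setT)[Z [c [_ h1 h2 h3]]]; exists Z, c; split.
  - by rewrite -cardsT.
  - by move=> z zZ; apply: h2; rewrite !inE zZ.
  - by move=> y z yZ zZ; apply: h3; rewrite !inE ?yZ ?zZ.
move=> U; have [n] := ubnP #|U|; elim: n U => // n IH U; rewrite ltnS => Un.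
have [->|[x xU]] := finset.set_0Vmem U.
  exists finset.set0, id; split=> //.
  - by rewrite cards0 mulr0.
  - by move=> z; rewrite !inE.
  - by move=> y z; rewrite !inE.
have [k kr hk] := small_sphere U x hf r1 e0 fr.
set P := grow U x k; set Q := grow U x k.+1.
have PQ : P \subset Q by apply: finset.subsetUl.
have QU : Q \subset U by apply: grow_sub.
have [|Z [c [ZU Ze hc1 hc2]]] := IH (U :\: Q).
  apply: leq_trans Un; apply/proper_card/properP; split; first exact: finset.subsetDl.
  by exists x => //; rewrite inE grow_root.
have inPQ z : z \in P -> z \in Q by apply: (fintype.subsetP PQ).
have PZ z : z \in P -> z \notin Z.
  by move=> zP; apply/negP => /(fintype.subsetP ZU); rewrite inE inPQ.
have cases z : z \in U :\: (Z :|: (Q :\: P)) -> z \notin P ->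
    z \in (U :\: Q) :\: Z.
  rewrite !finset.in_setD finset.in_setU finset.in_setD negb_or => /andP[/andP[-> +] ->].
  by rewrite negb_and negbK andbT => /orP[->|->].
(* A neighbour of [P] inside [U] lies in [Q]; since the sphere [Q :\: P] is discarded, a surviving
   neighbour lies in [P]. *)
have noedge y z : y \in P -> z \in U :\: (Z :|: (Q :\: P)) -> H y z -> z \in P.
  move=> yP zU yz; apply: contraT => zP; have := cases _ zU zP.
  rewrite inE => /andP[_]; rewrite inE => /andP[zQ zU'].
  by move: zQ; rewrite /Q /= !inE zU' negb_or => /andP[_ /exists_inP[]]; exists y.
exists (Z :|: (Q :\: P)), (fun z => if z \in P then x else c z); split.
- rewrite finset.subUset (fintype.subset_trans ZU) ?finset.subsetDl//.
  exact: fintype.subset_trans (finset.subsetDl _ _) QU.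
- apply: (@le_trans _ _ (#|Z|%:R + #|Q :\: P|%:R)).
    by rewrite -natrD ler_nat cardsU leq_subr.
  apply: (@le_trans _ _ (e * #|U :\: Q|%:R + e * #|P|%:R)); first exact: lerD.
  rewrite -mulrDr ler_wpM2l ?(ltW e0)// -natrD ler_nat.
  rewrite -(finset.cardsID Q U) (finset.setIidPr QU) addnC leq_add2r.
  exact: subset_leq_card.
- move=> z zU; case: ifPn => zP; last by apply/hc1/cases.
  apply: (dist_le_mono (ltnW kr)); apply/fballP.
  exact: (fintype.subsetP (grow_fball U x k)).
- move=> y z yU zU yz.
  case: ifPn => yP; case: ifPn => zP //.
  + by rewrite (noedge y) in zP.
  + by rewrite (noedge z) // adj_sym in yP.
  + by apply: hc2 => //; apply: cases.
Qed.
End Finite.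

(** * A slowly varying local partition of unity *)

Section Cover.
Variables (T : finType) (H : sgraph T) (R : realType).
Variables (q : R) (r N : nat).
Local Notation fball := (fball H).

(* The distance truncated at [r]. *)
Definition tdist (x z : T) : nat := \sum_(k < r) (z \notin fball k x).

Lemma tdist_max x z : (tdist x z <= r)%N.
Proof.
rewrite -[leqRHS]card_ord -sum1_card.
by apply: leq_sum => k _; exact: leq_b1.
Qed.

Lemma fball_mono k l x : (k <= l)%N -> fball k x \subset fball l x.
Proof.
move=> kl; apply/fintype.subsetP => z /fballP h.
by apply/fballP; apply: dist_le_mono kl h.
Qed.

(** Balls are nested, so the radii below [r] whose ball misses [z] form an initial segment, of
    length [tdist x z]. *)
Lemma tdist_le k x z : (k < r)%N -> (tdist x z <= k)%N = (z \in fball k x).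
Proof.
move=> kr; rewrite /tdist (bigID (fun i : 'I_r => (i < k)%N)) /=.
have cardk : (\sum_(i < r | (i < k)%N) 1 = k)%N.
  by rewrite (big_ord_narrow (ltnW kr)) sum1_card card_ord.
case: (boolP (z \in fball k x)) => zk.
  rewrite [X in (_ + X)%N]big1 ?addn0; last first.
    move=> i; rewrite -leqNgt => ki.
    by rewrite (fintype.subsetP (fball_mono x ki) _ zk).
  rewrite -[leqRHS]cardk; apply: leq_sum => i _. exact: leq_b1.
apply/negbTE; rewrite -ltnNge [X in (_ < _ + X)%N](bigD1 (Ordinal kr)) /=; last by rewrite ltnn.
rewrite zk addnCA add1n ltnS; apply: leq_trans (leq_addr _ _).
rewrite -[leqLHS]cardk; apply: leq_sum => i ik.
suff -> : z \notin fball i x by [].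
by apply: contra zk; apply/fintype.subsetP/fball_mono/ltnW.
Qed.

Lemma tdistC x z : tdist x z = tdist z x.
Proof. by apply: eq_bigr => k _; rewrite fballC. Qed.

Lemma tdist_lt x z : (tdist x z < r)%N -> z \in fball (tdist x z) x.
Proof. by move=> h; rewrite -tdist_le. Qed.

Lemma tdist_lt_fball x z : (tdist x z < r)%N -> z \in fball r x.
Proof. by move=> h; apply: (fintype.subsetP (fball_mono x (ltnW h))); exact: tdist_lt. Qed.

Lemma tdist_lip D x z p : dist_le H D z p -> (tdist x p <= tdist x z + D)%N.
Proof.
move=> zp; have [rD|Dr] := leqP r (tdist x z + D)%N.
  by apply: leq_trans (tdist_max _ _) rD.
rewrite tdist_le//; apply/fballP; apply: dist_le_trans zp; apply/fballP/tdist_lt.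
by apply: leq_ltn_trans Dr; apply: leq_addr.
Qed.

Lemma tdistxx x : tdist x x = 0%N.
Proof.
rewrite /tdist big1// => k _; suff -> : x \in fball k x by [].
by apply/fballP/dist_le_refl.
Qed.

Definition wt (x z : T) : R := q ^+ tdist x z - q ^+ r.
Definition wtot (z : T) : R := \sum_x wt x z.
(** The set where [N w x z / W z] is at least [j + 1], written without division. *)
Definition level (x : T) (j : nat) : {set T} :=
  [set z | j.+1%:R * wtot z <= N%:R * wt x z].

Hypotheses (q0 : 0 < q) (q1 : q < 1) (r1 : (1 <= r)%N).

Lemma qleX (a b : nat) : (a <= b)%N -> q ^+ b <= q ^+ a.
Proof. by move=> ab; apply: ler_wiXn2l => //; apply: ltW. Qed.

Lemma wt_ge0 x z : 0 <= wt x z.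
Proof. by rewrite subr_ge0 qleX ?tdist_max. Qed.

Lemma wt_gt0 x z : (0 < wt x z) = (tdist x z < r)%N.
Proof. by rewrite subr_gt0 ltr_iXn2l. Qed.

Lemma wt_eq0 x z : z \notin fball r x -> wt x z = 0.
Proof.
move=> h; apply/eqP; rewrite eq_le wt_ge0 andbT leNgt wt_gt0.
by apply: contra h; apply: tdist_lt_fball.
Qed.

Lemma wtot_ge z : 1 - q ^+ r <= wtot z.
Proof.
rewrite /wtot (bigD1 z)//= {1}/wt tdistxx expr0 lerDl.
by apply: sumr_ge0 => x _; apply: wt_ge0.
Qed.

Lemma wtot_gt0 z : 0 < wtot z.
Proof.
apply: lt_le_trans (wtot_ge z); rewrite subr_gt0 exprn_ilt1 ?ltW//.
by rewrite -lt0n.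
Qed.

(** Moving by [D] changes the truncated distance by at most [D], hence its power of [q] by a factor
    at most [1 + theta]. The term [q ^+ r] restores what was subtracted in [wt]; it is needed only
    if one of the points lies in the ball, as otherwise both weights vanish. *)
Lemma wt_diff D theta x z p : 0 <= theta -> 1 <= q ^+ D * (1 + theta) ->
  dist_le H D z p ->
  `|wt x z - wt x p| <=
    theta * (wt x z + q ^+ r * ((z \in fball r x)%:R + (p \in fball r x)%:R)).
Proof.
move=> t0 hD zp.
have az := tdist_lip x zp; have bp := tdist_lip x (dist_le_sym zp).
have key : `|wt x z - wt x p| <= theta * q ^+ tdist x z.
  have -> : wt x z - wt x p = q ^+ tdist x z - q ^+ tdist x p by rewrite /wt; ring.
  set a := tdist x z in az bp *; set b := tdist x p in az bp *.
  have qa : 0 < q ^+ a by rewrite exprn_gt0.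
  have qD : 0 < q ^+ D by rewrite exprn_gt0.
  rewrite ler_norml; apply/andP; split.
    have : q ^+ b * q ^+ D <= q ^+ a by rewrite -exprD qleX.
    have : q ^+ b <= q ^+ b * (q ^+ D * (1 + theta)).
      by rewrite ler_peMr// exprn_ge0// ltW.
    rewrite mulrA => h1 h2.
    have : q ^+ b * q ^+ D * (1 + theta) <= q ^+ a * (1 + theta).
      by rewrite ler_wpM2r//; lra.
    lra.
  have : q ^+ a * q ^+ D <= q ^+ b by rewrite -exprD qleX.
  have : q ^+ a <= q ^+ a * q ^+ D * (1 + theta).
    by rewrite -mulrA ler_peMr// exprn_ge0// ltW.
  have : q ^+ a * q ^+ D <= q ^+ a.
    by rewrite ler_piMr ?exprn_ile1 ?ltW// ltW.
  nra.
have [zr|zr] := boolP (z \in fball r x).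
  apply: le_trans key _; rewrite ler_wpM2l// /wt /=.
  have : 0 < q ^+ r by rewrite exprn_gt0.
  by case: (p \in _) => /=; lra.
have [pr|pr] := boolP (p \in fball r x).
  apply: le_trans key _; rewrite ler_wpM2l// /wt /=; lra.
by rewrite !wt_eq0// subrr normr0 /= !(mulr0n, addr0, mulr0) lexx.
Qed.

Variable B : nat.
Hypothesis hB : forall x, (#|fball r x| <= B)%N.

Lemma sum_fball z : \sum_x (z \in fball r x)%:R <= B%:R :> R.
Proof.
rewrite -natr_sum ler_nat; apply: leq_trans (hB z).
rewrite -sum1_card [leqRHS]big_mkcond /=; apply: leq_sum => x _.
by rewrite fballC; case: ifP.
Qed.

Definition share x z : R := N%:R * wt x z / wtot z.

Lemma sum_share z : \sum_x share x z = N%:R.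
Proof.
rewrite /share -mulr_suml -mulr_sumr mulfK//; apply: lt0r_neq0; exact: wtot_gt0.
Qed.

(** By the bound on [q ^+ r * B], the corrections [q ^+ r] of [wt_diff] add up to at most [1/2],
    which is below [wtot z]. So the weights, and hence their total, change by at most
    [2 theta wtot z]; normalising doubles this. *)
Lemma share_diff D theta z p : 0 <= theta -> 1 <= q ^+ D * (1 + theta) ->
  q ^+ r * B%:R <= 4^-1 -> q ^+ r <= 4^-1 -> dist_le H D z p ->
  \sum_x `|share x z - share x p| <= N%:R * (4 * theta).
Proof.
move=> t0 hD qB qr zp.
have Wz : 3 / 4 <= wtot z by apply: le_trans (wtot_ge z); lra.
have Wp := wtot_gt0 p.
have S1 : \sum_x `|wt x z - wt x p| <= theta * 2 * wtot z.
  apply: (@le_trans _ _ (\sum_x theta *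
    (wt x z + q ^+ r * ((z \in fball r x)%:R + (p \in fball r x)%:R)))).
    by apply: ler_sum => x _; apply: wt_diff hD zp.
  rewrite -mulr_sumr big_split /= -/(wtot z) -mulr_sumr big_split /= -mulrA.
  rewrite ler_wpM2l//.
  have qr0 : 0 <= q ^+ r by rewrite exprn_ge0// ltW.
  have := ler_wpM2l qr0 (sum_fball z); have := ler_wpM2l qr0 (sum_fball p).
  rewrite mulrDr; lra.
have S2 : `|wtot p - wtot z| <= theta * 2 * wtot z.
  rewrite distrC /wtot -sumrB; apply: le_trans S1; exact: ler_norm_sum.
rewrite /share.
have E x : `|N%:R * wt x z / wtot z - N%:R * wt x p / wtot p| <=
    N%:R / wtot z * `|wt x z - wt x p| +
    N%:R * (`|wtot p - wtot z| / (wtot z * wtot p)) * wt x p.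
  (* The change of the numerator is separated from that of the denominator; in the second term,
     summing over [x] cancels [wtot p]. *)
  have -> : N%:R * wt x z / wtot z - N%:R * wt x p / wtot p =
    N%:R / wtot z * (wt x z - wt x p) +
    N%:R * ((wtot p - wtot z) / (wtot z * wtot p)) * wt x p.
    by field; rewrite !lt0r_neq0//; lra.
  apply: le_trans (ler_normD _ _) _; rewrite !normrM !normr_nat.
  have -> : `|(wtot z)^-1| = (wtot z)^-1 by rewrite ger0_norm// invr_ge0; lra.
  have -> : `|(wtot z * wtot p)^-1| = (wtot z * wtot p)^-1.
    by rewrite ger0_norm// invr_ge0 mulr_ge0//; lra.
  by rewrite (ger0_norm (wt_ge0 _ _)).
apply: le_trans (ler_sum _ (fun x _ => E x)) _.
rewrite big_split /= -!mulr_sumr -/(wtot p).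
have -> : N%:R * (`|wtot p - wtot z| / (wtot z * wtot p)) * wtot p =
   N%:R / wtot z * `|wtot p - wtot z| by field; rewrite !lt0r_neq0//; lra.
rewrite -mulrDr -mulrA ler_wpM2l// mulrC ler_pdivrMr; lra.
Qed.

(** The number of heights [j < N] for which [z] lies in [level x j]. *)
Definition mult x z : nat := Num.truncn (share x z).

Lemma share_ge0 x z : 0 <= share x z.
Proof.
by rewrite /share divr_ge0 ?mulr_ge0 ?wt_ge0// ltW// wtot_gt0.
Qed.

Lemma level_mult x j z : (z \in level x j) = (j < mult x z)%N.
Proof.
rewrite inE /mult truncn_gt_nat /share ler_pdivlMr ?wtot_gt0//.
Qed.

Lemma mult_le x z : (mult x z <= N)%N.
Proof.
rewrite -(ler_nat R); apply: (@le_trans _ _ (share x z)).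
  by rewrite /mult truncn_le share_ge0.
rewrite -(sum_share z) (bigD1 x)//= lerDl; apply: sumr_ge0 => y _.
exact: share_ge0.
Qed.

(** Rounding down loses at most 1, and nothing outside the ball, where the share is 0. *)
Lemma mult_share x z : `|(mult x z)%:R - share x z| <= (z \in fball r x)%:R.
Proof.
have [zr|zr] := boolP (z \in fball r x).
  have /andP[] := truncn_itv (share_ge0 x z).
  rewrite -/(mult x z) -[_.+1]addn1 natrD ler_norml => h1 h2.
  by apply/andP; split; rewrite /=; lra.
by rewrite /mult /share wt_eq0// mulr0 mul0r truncn0 subrr normr0.
Qed.

Lemma sum_ord_lt (t : nat) : (t <= N)%N ->
  \sum_(j < N) (j < t)%N%:R = t%:R :> R.
Proof.
move=> tN; rewrite -natr_sum; congr (_%:R).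
by rewrite -big_mkcond /= (big_ord_narrow tN) sum1_card card_ord.
Qed.

Lemma sum_ord_diff (t s : nat) : (t <= N)%N -> (s <= N)%N ->
  \sum_(j < N) `|(j < t)%N%:R - (j < s)%N%:R| = `|t%:R - s%:R| :> R.
Proof.
wlog ts : t s / (t <= s)%N => [hw tN sN|tN sN].
  have [ts|/ltnW st] := leqP t s; first exact: hw.
  by rewrite distrC -hw//; apply: eq_bigr => j _; rewrite distrC.
rewrite distrC ger0_norm ?subr_ge0 ?ler_nat// -(sum_ord_lt tN) -(sum_ord_lt sN).
rewrite -sumrB; apply: eq_bigr => j _; rewrite distrC ger0_norm// subr_ge0 ler_nat.
by case: (ltnP j t) => // jt; rewrite (leq_trans jt ts).
Qed.

(** The shares at [z] sum to [N]; rounding costs at most 1 for each of the at most [B] vertices [x]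
    whose ball contains [z]. *)
Lemma level_total z :
  `|\sum_x \sum_(j < N) (z \in level x j)%:R - N%:R| <= B%:R :> R.
Proof.
apply: le_trans (sum_fball z); rewrite -{1}(sum_share z) -sumrB.
apply: le_trans (ler_norm_sum _ _ _) _; apply: ler_sum => x _.
apply: le_trans (mult_share x z); under eq_bigr do rewrite level_mult.
by rewrite sum_ord_lt ?mult_le.
Qed.

(** The levels of [x] are nested, so those separating [z] from [p] number the difference of the
    multiplicities. This is the difference of the shares up to rounding at both points. *)
Lemma level_diff D theta z p : 0 <= theta -> 1 <= q ^+ D * (1 + theta) ->
  q ^+ r * B%:R <= 4^-1 -> q ^+ r <= 4^-1 -> dist_le H D z p ->
  \sum_x \sum_(j < N) `|(z \in level x j)%:R - (p \in level x j)%:R| <=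
    N%:R * (4 * theta) + 2 * B%:R :> R.
Proof.
move=> t0 hD qB qr zp.
apply: (@le_trans _ _ (\sum_x `|share x z - share x p| +
    (\sum_x (z \in fball r x)%:R + \sum_x (p \in fball r x)%:R))).
  rewrite -!big_split /=; apply: ler_sum => x _.
  under eq_bigr do rewrite !level_mult.
  rewrite sum_ord_diff ?mult_le//.
  have := mult_share x z; have := mult_share x p.
  have := ler_norm (share x z - share x p).
  have := lerNnormlW (lexx `|share x z - share x p|).
  by rewrite !ler_norml => ? ? /andP[? ?] /andP[? ?]; apply/andP; split; lra.
have := share_diff t0 hD qB qr zp; have := sum_fball z; have := sum_fball p.
by lra.
Qed.
End Cover.

(** * Almost additive functions on vertex sets *)

Section Approx.
Variables (T : finType) (H : sgraph T) (R : realType).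
Variables (h : {set T} -> R) (C : R).
Hypotheses (C0 : 0 <= C) (h0 : h finset.set0 = 0)
  (hlip : forall S v, h S <= h (v |: S) <= h S + C)
  (hadd : forall S S' : {set T}, [disjoint S & S'] ->
     (forall x y, x \in S -> y \in S' -> ~~ H x y) -> h (S :|: S') = h S + h S').

Lemma lip_sub (S S' : {set T}) : S \subset S' ->
  h S <= h S' <= h S + C * #|S' :\: S|%:R.
Proof.
have [n] := ubnP #|S' :\: S|; elim: n S' => // n IH S' le sub.
have [e|[v]] := finset.set_0Vmem (S' :\: S).
  have -> : S' = S.
    by apply/eqP; rewrite finset.eqEsubset sub -finset.setD_eq0 e eqxx.
  by rewrite finset.setDv cards0 mulr0 addr0 !lexx.
rewrite inE => /andP[vS vS'].
have e : S' = v |: (S' :\ v) by rewrite finset.setD1K.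
have e2 : S' :\: S = v |: ((S' :\ v) :\: S).
  by apply/finset.setP => x; rewrite !inE; case: eqVneq => [->|]; rewrite ?vS ?vS'.
have vn : v \notin (S' :\ v) :\: S by rewrite !inE eqxx andbF.
have := IH (S' :\ v); rewrite e2 cardsU1 vn in le *.
case/(_ _ _)/andP => //.
  by rewrite finset.subsetD1 sub.
move=> l1 l2; have /andP[l3 l4] := hlip (S' :\ v) v.
rewrite -e in l3 l4; rewrite natrD mulrDr mulr1.
by apply/andP; split; lra.
Qed.

Variables (Z : {set T}) (c : T -> T).
Hypothesis hc : forall y z, y \notin Z -> z \notin Z -> H y z -> c y = c z.

(** The pieces are the fibres of the centre map off [Z]; a vertex that is not a centre indexes an
    empty piece, on which [h] vanishes. *)
Definition piece p : {set T} := [set z | (z \notin Z) && (c z == p)].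

(** By [hc] no edge joins two different pieces, so additivity applies as the pieces are added one at
    a time. *)
Lemma h_pieces A : h (A :\: Z) = \sum_p h (piece p :&: A).
Proof.
suff P (s : seq T) : uniq s ->
    h [set z in A :\: Z | c z \in s] = \sum_(p <- s) h (piece p :&: A).
  rewrite -big_enum -P ?enum_uniq//; congr h.
  by apply/finset.setP => z; rewrite !inE mem_enum andbT.
elim: s => [_|p s IH /= /andP[ps us]].
  rewrite big_nil -h0; congr h; apply/finset.setP => z.
  by rewrite !inE andbF.
rewrite big_cons -IH// -hadd.
- congr h; apply/finset.setP => z; rewrite !inE.
  by case: (z \in Z); case: (z \in A); rewrite /= ?andbF ?andbT ?orbF.
- rewrite disjoint_subset; apply/fintype.subsetP => z; rewrite !inE.
  by move=> /andP[/andP[_ /eqP->] _]; rewrite negb_and ps orbT.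
- move=> x y; rewrite !inE => /andP[/andP[xZ /eqP cx] _] /andP[/andP[yZ _] cy].
  by apply/negP => xy; move: ps; rewrite -cx (hc xZ yZ xy) cy.
Qed.

Lemma lip0 (S : {set T}) : 0 <= h S <= C * #|S|%:R.
Proof.
by have := @lip_sub finset.set0 S (finset.sub0set _); rewrite h0 add0r finset.setD0.
Qed.

Lemma card_indic (S A : {set T}) : #|S :&: A|%:R = \sum_(z in S) (z \in A)%:R :> R.
Proof.
rewrite -natr_sum; congr (_%:R); rewrite -sum1_card big_mkcond [RHS]big_mkcond.
by apply: eq_bigr => z _; rewrite inE; case: (z \in S); case: (z \in A).
Qed.

Lemma card_indicD (S A : {set T}) :
  #|S :\: A|%:R = \sum_(z in S) (1 - (z \in A)%:R) :> R.
Proof.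
rewrite finset.setDE card_indic; apply: eq_bigr => z _; rewrite inE.
by case: (z \in A); rewrite ?subrr ?subr0.
Qed.

(** The piece is treated as entirely inside or outside [A] according to its centre [p]; each vertex
    that disagrees with [p] costs at most [C]. *)
Lemma h_piece p A : `|h (piece p :&: A) - (p \in A)%:R * h (piece p)| <=
  C * \sum_(z in piece p) `|(z \in A)%:R - (p \in A)%:R|.
Proof.
case: (boolP (p \in A)) => pA.
  have := lip_sub (finset.subsetIl (piece p) A).
  rewrite finset.setDIr finset.setDv finset.set0U card_indicD mul1r => /andP[l1 l2].
  under eq_bigr => z _.
    rewrite distrC ger0_norm; last by case: (_ \in _); rewrite ?subrr ?subr0.
    over.
  by rewrite ler_norml; apply/andP; split; lra.
have := lip0 (piece p :&: A); rewrite card_indic mul0r subr0 => /andP[l1 l2].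
by under eq_bigr do rewrite subr0 normr_nat; rewrite ger0_norm.
Qed.

Lemma sum_piece (F : T -> R) :
  \sum_p \sum_(z in piece p) F z = \sum_(z | z \notin Z) F z.
Proof.
rewrite [RHS](partition_big c xpredT)//=; apply: eq_bigr => p _.
by apply: eq_bigl => z; rewrite inE.
Qed.

(** The cost is [C] for each vertex of [A] lost in [Z] and for each vertex that [A] separates from
    its centre. *)
Lemma h_approx A : `|h A - \sum_p (p \in A)%:R * h (piece p)| <=
  C * (\sum_(z in Z) (z \in A)%:R +
       \sum_(z | z \notin Z) `|(z \in A)%:R - (c z \in A)%:R|).
Proof.
have h1 : `|h A - h (A :\: Z)| <= C * \sum_(z in Z) (z \in A)%:R.
  have := lip_sub (finset.subsetDl A Z).
  rewrite finset.setDDr finset.setDv finset.set0U finset.setIC card_indic.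
  by move=> /andP[l1 l2]; rewrite ger0_norm; lra.
have h2 : `|h (A :\: Z) - \sum_p (p \in A)%:R * h (piece p)| <=
    C * \sum_(z | z \notin Z) `|(z \in A)%:R - (c z \in A)%:R|.
  rewrite h_pieces -sumrB; apply: le_trans (ler_norm_sum _ _ _) _.
  rewrite -sum_piece mulr_sumr; apply: ler_sum => p _.
  apply: le_trans (h_piece p A) _; rewrite ler_wpM2l//; apply: ler_sum => z.
  by rewrite inE => /andP[_ /eqP->].
by apply: le_trans (ler_distD (h (A :\: Z)) _ _) _; rewrite mulrDr lerD.
Qed.

Lemma h_approxT : `|h finset.setT - \sum_p h (piece p)| <= C * #|Z|%:R.
Proof.
have := h_approx finset.setT.
under eq_bigr do rewrite inE mul1r.
rewrite -card_indic finset.setIT [X in C * (_ + X)]big1 ?addr0// => z _.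
by rewrite !inE subrr normr0.
Qed.

Variables (q : R) (r N B D : nat) (theta : R).
Hypotheses (q0 : 0 < q) (q1 : q < 1) (r1 : (1 <= r)%N).
Hypothesis hB : forall x, (#|fball H r x| <= B)%N.
Hypotheses (t0 : 0 <= theta) (hD : 1 <= q ^+ D * (1 + theta))
  (qB : q ^+ r * B%:R <= 4^-1) (qr : q ^+ r <= 4^-1)
  (cD : forall z, z \notin Z -> dist_le H D (c z) z).

(** The local quantity: the layer-cake sum of [h] over the superlevel sets attached to [x]. *)
Definition theta_sum x : R := \sum_(j < N) h (level H q r N x j).
Local Notation level := (level H q r N).

Lemma cover_approx : `|\sum_x theta_sum x - N%:R * h finset.setT| <=
  C * (2 * N%:R * #|Z|%:R + #|T|%:R * (4 * theta * N%:R + 4 * B%:R)).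
Proof.
have ZT : #|Z|%:R <= #|T|%:R :> R by rewrite ler_nat max_card.
have B0 : 0 <= B%:R :> R by [].
(* First, [h] of each level is replaced by the sum over the pieces whose centre lies in that
   level. *)
have t1 : `|\sum_x theta_sum x -
      \sum_x \sum_(j < N) \sum_p (p \in level x j)%:R * h (piece p)| <=
    C * (#|Z|%:R * (N%:R + B%:R) + #|T|%:R * (N%:R * (4 * theta) + 2 * B%:R)).
  rewrite -sumrB; apply: le_trans (ler_norm_sum _ _ _) _.
  apply: (@le_trans _ _ (\sum_x \sum_(j < N) (C * (\sum_(z in Z) (z \in level x j)%:R +
       \sum_(z | z \notin Z) `|(z \in level x j)%:R - (c z \in level x j)%:R|)))).
    apply: ler_sum => x _; rewrite -sumrB; apply: le_trans (ler_norm_sum _ _ _) _.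
    by apply: ler_sum => j _; exact: h_approx.
  under eq_bigr do rewrite -mulr_sumr.
  rewrite -mulr_sumr ler_wpM2l//.
  under eq_bigr do rewrite big_split/= exchange_big/= [X in _ + X]exchange_big/=.
  rewrite big_split/= exchange_big/= [X in _ + X]exchange_big/= lerD//.
    rewrite -sum1_card natr_sum mulr_suml; apply: ler_sum => z _; rewrite mul1r.
    have := level_total N q0 q1 r1 hB z.
    by rewrite ler_norml => /andP[_]; lra.
  apply: (@le_trans _ _ (\sum_(z : T | z \notin Z) (N%:R * (4 * theta) + 2 * B%:R))).
    apply: ler_sum => z zZ; apply: (level_diff N q0 q1 r1 hB t0 hD qB qr).
    exact/dist_le_sym/cD.
  rewrite sumr_const -[leLHS]mulr_natl ler_wpM2r ?ler_nat ?max_card//.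
  by rewrite addr_ge0// !mulr_ge0.
(* Second, each centre lies in [N] levels up to [B], so each piece is counted about [N] times; the
   error per piece is weighted by [h (piece p)], at most [C] times its size. *)
have t2 : `|\sum_x \sum_(j < N) \sum_p (p \in level x j)%:R * h (piece p) -
      N%:R * \sum_p h (piece p)| <= C * (#|T|%:R * B%:R).
  under eq_bigr do rewrite exchange_big /=.
  rewrite exchange_big /= mulr_sumr -sumrB; apply: le_trans (ler_norm_sum _ _ _) _.
  apply: (@le_trans _ _ (\sum_p \sum_(z in piece p) (C * B%:R))).
    apply: ler_sum => p _; rewrite sumr_const -[leRHS]mulr_natl.
    under eq_bigr do rewrite -mulr_suml.
    rewrite -mulr_suml -mulrBl normrM mulrC mulrCA [C * (_ * _)]mulrA.
    have /andP[l1 l2] := lip0 (piece p).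
    by rewrite ger0_norm// ler_pM// (level_total N q0 q1 r1 hB).
  rewrite sum_piece sumr_const -[leLHS]mulr_natl mulrCA ler_wpM2l//.
  by rewrite ler_wpM2r// ler_nat max_card.
(* Third, the pieces are reassembled, at the cost of [Z]. *)
have t3 : `|N%:R * \sum_p h (piece p) - N%:R * h finset.setT| <= C * (N%:R * #|Z|%:R).
  by rewrite -mulrBr normrM normr_nat distrC mulrCA ler_wpM2l// h_approxT.
have B1 : #|Z|%:R * B%:R <= #|T|%:R * B%:R :> R by rewrite ler_wpM2r.
have B2 := ler_wpM2l C0 B1.
apply: le_trans (ler_distD _ _ _) (le_trans (lerD t1 (le_trans (ler_distD _ _ _) (lerD t2 t3))) _).
lra.
Qed.
End Approx.

Lemma bernoulli_le (R : realDomainType) (u : R) n : 0 <= u <= 1 ->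
  1 - n%:R * u <= (1 - u) ^+ n.
Proof.
move=> /andP[u0 u1]; elim: n => [|n IH]; first by rewrite mul0r subr0 expr0.
rewrite exprS -[n.+1]add1n natrD mulrDl mul1r.
apply: (@le_trans _ _ ((1 - u) * (1 - n%:R * u))); last by rewrite ler_wpM2l// subr_ge0.
have : 0 <= u * (n%:R * u) by rewrite !mulr_ge0.
lra.
Qed.

(** The parameters are fixed from [f] and [e] alone, in the order [D], [q], [r], [N]. The three
    errors of [cover_approx], from [Z], from [theta] and from rounding, then contribute at most
    [e/4] each, relative to [C N |T|]. *)
Lemma uniform_approx (R : realType) (f : nat -> nat) (e : R) :
  subexponential R f -> 0 < e ->
  exists (q : R) (r N : nat), [/\ (1 <= r)%N, (0 < N)%N &
    forall (T : finType) (H : sgraph T) (h : {set T} -> R) (C : R),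
      growth_le H f -> 0 <= C -> h finset.set0 = 0 ->
      (forall S v, h S <= h (v |: S) <= h S + C) ->
      (forall S S' : {set T}, [disjoint S & S'] ->
        (forall x y, x \in S -> y \in S' -> ~~ H x y) ->
        h (S :|: S') = h S + h S') ->
      0 < q < 1 /\
      `|\sum_x theta_sum H h q r N x - N%:R * h finset.setT| <=
        C * e * (N%:R * #|T|%:R)].
Proof.
move=> hf e0.
have e8 : 0 < 1 + e / 8 by lra.
have e8' : 0 < e / 8 by lra.
(* [D] bounds the radius of the pieces in a carving that discards at most a proportion [e/8] of the
   vertices. *)
have [D D1 hD] : exists2 r : nat, (1 <= r)%N & (f r)%:R < (1 + e / 8) ^+ r.
  have q0 : 0 < (1 + e / 8)^-1 < 1 by rewrite invr_gt0 e8 invf_lt1//; lra.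
  have [r r1 h] := subexponential_decay hf q0 ltr01; exists r => //.
  by move: h; rewrite exprVn ltr_pdivrMr ?exprn_gt0// mul1r.
pose th := e / 16; have th0 : 0 < th by rewrite /th; lra.
(* With [q = 1 - u], Bernoulli's inequality gives [q ^+ D >= 1 / (1 + th)]. *)
pose u := th / ((1 + th) * D.+1%:R).
have D0 : 0 < D.+1%:R :> R by [].
have u0 : 0 < u by rewrite divr_gt0// mulr_gt0//; lra.
have Du : D%:R * u <= th / (1 + th).
  suff -> : D%:R * u = th / (1 + th) - u by lra.
  by rewrite /u -[D.+1]addn1 natrD; field; rewrite natr1 !lt0r_neq0//; lra.
have u1 : u < 1.
  rewrite /u ltr_pdivrMr ?mulr_gt0//; last lra.
  have : 1 <= D.+1%:R :> R by rewrite ler1n.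
  have : 0 < th * D.+1%:R by rewrite mulr_gt0.
  nra.
have hq : 1 <= (1 - u) ^+ D * (1 + th).
  have : 1 - D%:R * u <= (1 - u) ^+ D by apply: bernoulli_le; lra.
  rewrite -ler_pdivrMr; last lra.
  apply: le_trans; have -> : 1 / (1 + th) = 1 - th / (1 + th) by field; lra.
  lra.
have q01 : 0 < 1 - u < 1 by lra.
have p4 : 0 < 4^-1 :> R by [].
have [r r1 hr] := subexponential_decay hf q01 p4.
(* [N] is so large that the rounding error [4 f r] is at most [e/4 * N]. *)
pose N := (Num.truncn (16 * (f r)%:R / e)).+1.
have hN : 4 * (f r)%:R <= e / 4 * N%:R.
  have := truncnS_gt (16 * (f r)%:R / e); rewrite -/N ltr_pdivrMr//; lra.
exists (1 - u), r, N; split=> // T H h C hg C0 h0 hlip hadd; split=> //.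
(* The empty graph is treated apart; otherwise a vertex yields [1 <= f r], from which [qr]
   follows. *)
have [x0|T0] := pickP (mem T); last first.
  have -> : h finset.setT = 0.
    by rewrite -h0; congr h; apply/finset.setP => x; have := T0 x.
  rewrite mulr0 subr0 big1 ?normr0 ?mulr_ge0//; first exact: ltW.
  by move=> x; have := T0 x.
move=> _; have [Z [c [hZ hc1 hc2]]] := carving hg D1 e8' hD.
have q0 : 0 < 1 - u by case/andP: q01.
have q1 : 1 - u < 1 by case/andP: q01.
have hB x := card_fball x hg r1.
have qB : (1 - u) ^+ r * (f r)%:R <= 4^-1 by rewrite mulrC ltW.
have f1 : 1 <= (f r)%:R :> R.
  rewrite ler1n; apply: leq_trans (hB x0); apply/card_gt0P; exists x0.
  exact/fballP/dist_le_refl.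
have qr : (1 - u) ^+ r <= 4^-1.
  by apply: le_trans qB; rewrite ler_peMr// exprn_ge0// ltW.
have := cover_approx C0 h0 hlip hadd hc2 N q0 q1 r1 hB (ltW th0) hq qB qr hc1.
move=> /le_trans; apply.
rewrite -[leRHS]mulrA ler_wpM2l//.
have n0 : 0 <= N%:R :> R by [].
have t0 : 0 <= #|T|%:R :> R by [].
have := mulr_ge0 (ltW e0) (mulr_ge0 n0 t0).
have := ler_wpM2l n0 hZ; have := ler_wpM2l t0 hN; rewrite /th; lra.
Qed.

(** * Locality *)

Section Embedding.
Variables (K T : finType) (A : sgraph K) (H : sgraph T) (e : K -> T) (a : K).
Hypotheses (einj : injective e) (eadj : forall u v, H (e u) (e v) = A u v).

Variable rho : nat.
Hypothesis eball : forall z, dist_le H rho (e a) z -> exists u, e u = z.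

(** A path of length at most [k] that starts within [s] of the root stays in the ball of radius
    [rho], which the embedding covers, so it lifts step by step. *)
Lemma dist_le_lift s k u z : (s + k <= rho)%N -> dist_le H s (e a) (e u) ->
  dist_le H k (e u) z -> exists2 w, e w = z & dist_le A k u w.
Proof.
move=> + + [p [+ <- sp]] {z}.
elim: p s k sp u => [|z p IH] s k sp u sk au /=.
  by move=> _; exists u => //; exists [::].
case: k sp sk => // k sp sk /andP[uz zp].
have az : dist_le H s.+1 (e a) z.
  by rewrite -addn1; exact: dist_le_trans au (dist_le1 uz).
have [w wz] : exists w, e w = z.
  by apply: eball; apply: (dist_le_mono _ az); lia.
subst z; have [w' <- ww'] := IH s.+1 k sp w ltac:(lia) az zp.
exists w' => //; rewrite -add1n; apply: dist_le_trans ww'; apply: dist_le1.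
by rewrite -eadj.
Qed.

Lemma dist_le_embE s k u w : (s + k <= rho)%N -> dist_le H s (e a) (e u) ->
  dist_le H k (e u) (e w) <-> dist_le A k u w.
Proof.
move=> sk au; split; last by apply: dist_le_morph => x y; rewrite eadj.
by move=> /(dist_le_lift sk au)[w' /einj->].
Qed.

Variables (R : realType) (q : R) (r N : nat).
Hypotheses (q0 : 0 < q) (q1 : q < 1) (r1 : (1 <= r)%N) (hrho : (r + r <= rho)%N).

Lemma tdist_emb u w : dist_le H r (e a) (e u) ->
  tdist H r (e u) (e w) = tdist A r u w.
Proof.
move=> au; apply: eq_bigr => k _; congr (nat_of_bool (~~ _)).
have sk : (r + k <= rho)%N by apply: leq_trans hrho; rewrite leq_add2l ltnW.
by apply/fballP/fballP => ?; apply/(dist_le_embE w sk au).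
Qed.

Lemma wt_emb u w : dist_le H r (e a) (e u) -> wt H q r (e u) (e w) = wt A q r u w.
Proof. by move=> au; rewrite /wt tdist_emb. Qed.

Lemma wtC (T' : finType) (H' : sgraph T') x z : wt H' q r x z = wt H' q r z x.
Proof. by rewrite /wt tdistC. Qed.

(** Vertices within [r] of [e u] are in the image because [r + r <= rho]; all others have weight
    0. *)
Lemma wtot_emb u : dist_le H r (e a) (e u) -> wtot H q r (e u) = wtot A q r u.
Proof.
move=> au; rewrite /wtot (bigID (mem (e @: finset.setT))) /= [X in _ + X]big1 ?addr0.
  rewrite big_imset /=; last by move=> x y _ _; apply: einj.
  apply: eq_big => [x|w _]; first by rewrite inE.
  by rewrite wtC [RHS]wtC wt_emb.
move=> z zn; rewrite wtC; apply: wt_eq0 => //; apply: contra zn => /fballP uz.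
by have [w <- _] := dist_le_lift hrho au uz; apply: imset_f.
Qed.

(** A level at [e a] lies in the ball of radius [r], and the totals at its points involve vertices
    up to distance [r + r]. *)
Lemma level_emb j : level H q r N (e a) j = e @: level A q r N a j.
Proof.
have aa : dist_le H r (e a) (e a) by apply: dist_le_refl.
apply/finset.setP => z; apply/idP/imsetP.
  rewrite inE => hz.
  (* The lowest height is 1 and not 0, so membership in a level forces a positive weight. *)
  have w0 : 0 < wt H q r (e a) z.
    have : 0 < j.+1%:R * wtot H q r z by rewrite mulr_gt0// wtot_gt0.
    move=> /lt_le_trans/(_ hz); rewrite pmulr_rgt0// ltr0n lt0n.
    by apply: contraTneq hz => ->; rewrite mul0r -ltNge mulr_gt0// wtot_gt0.
  have az : dist_le H r (e a) z.
    by apply/fballP/tdist_lt_fball; rewrite -(wt_gt0 H r q0 q1).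
  have [w wz] : exists w, e w = z.
    by apply: eball; apply: (dist_le_mono _ az); apply: leq_trans hrho; apply: leq_addr.
  by subst z; exists w => //; rewrite inE -wtot_emb// -wt_emb.
move=> [w hw ->]; move: (hw); rewrite !inE wt_emb//.
have [aw|aw] := boolP (e w \in fball H r (e a)).
  by rewrite wtot_emb//; apply/fballP.
rewrite -(wt_emb w aa) wt_eq0// mulr0 => hw0; exfalso.
have : 0 < j.+1%:R * wtot A q r w by rewrite mulr_gt0// wtot_gt0.
by move=> /lt_le_trans/(_ hw0); rewrite ltxx.
Qed.

Variables (hT : {set T} -> R) (hK : {set K} -> R).
Hypothesis hinv : forall S : {set K}, hT (e @: S) = hK S.

Lemma theta_emb : theta_sum H hT q r N (e a) = theta_sum A hK q r N a.
Proof. by apply: eq_bigr => j _; rewrite level_emb hinv. Qed.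

End Embedding.

(** * Rooted isomorphisms and a finite list of ball types *)

Lemma rooted_iso_sym (V W : Type) (G : sgraph V) x (H : sgraph W) y :
  rooted_iso G x H y -> rooted_iso H y G x.
Proof.
case=> h [[g hg gh] hx hadj]; exists g; split; first by exists h.
- by rewrite -hx hg.
- by move=> u v; rewrite -hadj !gh.
Qed.

Lemma rooted_iso_trans (V W U : Type) (G : sgraph V) x (H : sgraph W) y
    (K : sgraph U) z :
  rooted_iso G x H y -> rooted_iso H y K z -> rooted_iso G x K z.
Proof.
case=> h [bh hx hadj] [k [bk ky kadj]]; exists (k \o h); split.
- exact: bij_comp.
- by rewrite /= hx.
- by move=> u v; rewrite /= kadj hadj.
Qed.

(** An isomorphism with a ball, inverted and followed by the inclusion, is an induced embedding onto
    that ball, as the locality lemmas require. *)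
Lemma rooted_iso_emb (K T : Type) (A : sgraph K) (H : sgraph T) a x rho :
  rooted_iso (ball_graph H rho x) (ball_root H rho x) A a ->
  exists e : K -> T, [/\ injective e, e a = x, forall u v, H (e u) (e v) = A u v,
    forall z, dist_le H rho x z -> exists u, e u = z &
    forall u, dist_le H rho x (e u)].
Proof.
move=> iso; have [h [[g hg gh] ha hadj]] := rooted_iso_sym iso.
exists (fun u => val (h u)); split.
- by move=> u v /val_inj /(can_inj hg).
- by rewrite ha.
- by move=> u v; rewrite -hadj.
- move=> z xz; have zb : z \in gball H rho x by rewrite inE.
  by exists (g (exist _ z zb)); rewrite gh.
- by move=> u; have := valP (h u); rewrite inE.
Qed.

(** Used in contrapositive form: a rooted graph that is not a patch never occurs as a ball, so its
    frequency is 0. *)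
Lemma rooted_iso_patch (K T : finType) (A : sgraph K) (H : sgraph T) a x rho d :
  rooted_iso (ball_graph H rho x) (ball_root H rho x) A a ->
  max_degree_le H d -> is_patch rho d A a.
Proof.
move=> iso hd; have [e [einj ea eadj eball eim]] := rooted_iso_emb iso; subst x.
have ay y : dist_le A rho a y.
  have r0 : (0 + rho <= rho)%N by [].
  by have [w /einj -> ] := dist_le_lift eadj eball r0 (dist_le_refl _ _ _) (eim y).
split=> // [u v|u].
  by exists (rho + rho)%N; apply: dist_le_trans (ay v); apply/dist_le_sym.
apply: card_le_trans (hd (e u)).
have ei : {in [set y | A u y]%classic &, injective e} by move=> y z _ _ /einj.
rewrite -(card_le_eql (inj_card_eq ei)).
by apply: subset_card_le => _ [y /= uy <-]; rewrite /= eadj.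
Qed.

Section Codes.
Variable M : nat.

(* All rooted relations on at most [M] labelled vertices; [code_graph] turns the
   relation into a simple graph. *)
Definition code : finType :=
  {m : 'I_M.+1 & ({ffun 'I_m * 'I_m -> bool} * 'I_m)%type}.

Definition code_rel (c : code) : rel 'I_(tag c) :=
  [rel x y | (x != y) && ((tagged c).1 (x, y) || (tagged c).1 (y, x))].

Lemma code_sym (c : code) : symmetric (@code_rel c).
Proof. by move=> x y; rewrite /code_rel /= eq_sym orbC. Qed.

Lemma code_irr (c : code) : irreflexive (@code_rel c).
Proof. by move=> x; rewrite /code_rel /= eqxx. Qed.

Definition code_graph (c : code) : sgraph 'I_(tag c) := SGraph (@code_sym c) (@code_irr c).
Definition code_root (c : code) : 'I_(tag c) := (tagged c).2.

Lemma code_exists (T : finType) (H : sgraph T) rho x : (#|fball H rho x| <= M)%N ->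
  exists c, rooted_iso (ball_graph H rho x) (ball_root H rho x)
                       (code_graph c) (code_root c).
Proof.
rewrite -ltnS => hM.
have xx : x \in fball H rho x by apply/fballP/dist_le_refl.
pose rk (y : T) : 'I_#|fball H rho x| := enum_rank_in xx y.
pose m : 'I_M.+1 := Ordinal hM.
pose c : code := @Tagged _ m (fun m : 'I_M.+1 => ({ffun 'I_m * 'I_m -> bool} * 'I_m)%type)
  ([ffun p : 'I_m * 'I_m => H (enum_val p.1) (enum_val p.2)], rk x).
exists c; apply: rooted_iso_sym.
have hb (i : 'I_m) : enum_val i \in gball H rho x.
  by rewrite inE; apply/fballP; apply: enum_valP.
exists (fun i : 'I_m => exist _ (enum_val i) (hb i) : gball H rho x); split.
- exists (fun y : gball H rho x => rk (val y)).
    by move=> i; rewrite /= /rk enum_valK_in.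
  move=> y; apply: val_inj; rewrite /= /rk enum_rankK_in//.
  by apply/fballP; have := valP y; rewrite inE.
- by apply: val_inj; rewrite /= /rk enum_rankK_in.
- move=> u v; rewrite /= /code_rel /= !ffunE /= [X in _ || X]adj_sym orbb.
  by case: eqVneq => //= ->; rewrite adj_irr.
Qed.
End Codes.

(** Such a sequence is Cauchy: it is eventually within [e] of the limit of the approximating [v]. *)
Lemma cvgn_approx (R : realType) (u : nat -> R) :
  (forall e : R, 0 < e -> exists2 v : nat -> R, cvgn v &
     forall n, `|u n - v n| <= e) -> cvgn u.
Proof.
move=> h; apply: cauchy_cvg; apply: cauchy_exP => e e0.
have e2 : 0 < e / 2 by lra.
have [v cv uv] := h _ e2; exists (limn v).
have /cvgrPdist_lt/(_ (e / 2) e2) := cv; apply: filterS => n vn.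
by rewrite -ball_normE /= -(subrKA (v n)) (le_lt_trans (ler_normD _ _))//
  (splitr e) ltr_leD// distrC.
Qed.

(** Stronger than isomorphism invariance: the value at [S] depends only on the graph induced on [S],
    so it may be computed in a ball instead of the whole graph. *)
Definition induced_invariant (R : realType)
    (h : forall T : finType, sgraph T -> {set T} -> R) : Prop :=
  forall (K T : finType) (A : sgraph K) (H : sgraph T) (e : K -> T),
    injective e -> (forall u v, H (e u) (e v) = A u v) ->
    forall S : {set K}, h T H (e @: S) = h K A S.

(** * Averages of the local quantity *)

Section Average.
Variables (R : realType) (h : forall T : finType, sgraph T -> {set T} -> R).
Hypothesis hinv : induced_invariant h.
Variables (q : R) (r N M : nat).
Hypotheses (q0 : 0 < q) (q1 : q < 1) (r1 : (1 <= r)%N).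
Local Notation theta H := (theta_sum H (h H) q r N).

Lemma theta_iso (T K : finType) (H : sgraph T) (A : sgraph K) x a :
  rooted_iso (ball_graph H (r + r) x) (ball_root H (r + r) x) A a ->
  theta H x = theta A a.
Proof.
move=> iso; have [e [einj ea eadj eball _]] := rooted_iso_emb iso; subst x.
apply: (theta_emb einj eadj eball N q0 q1 r1 (leqnn _)).
exact: hinv.
Qed.

Definition code_iso (c c' : code M) : Prop :=
  rooted_iso (code_graph c) (code_root c) (code_graph c') (code_root c').

(* [code] lists an isomorphism type once per labelling, hence the division by
   the number of labellings. *)
Definition code_weight (c : code M) : R :=
  theta (code_graph c) (code_root c) / #|[pred c' | `[< code_iso c c' >]]|%:R.

(** Each vertex spreads its value evenly over the codes of its ball; exchanging the sums collects
    the vertices having a given ball. *)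
Lemma theta_average (T : finType) (H : sgraph T) :
  (forall x, (#|fball H (r + r) x| <= M)%N) ->
  (\sum_x theta H x) / #|T|%:R =
  \sum_c patch_freq R H (r + r) (code_graph c) (code_root c) * code_weight c.
Proof.
move=> hM; rewrite /patch_freq.
pose P x c := `[< rooted_iso (ball_graph H (r + r) x) (ball_root H (r + r) x)
  (code_graph c) (code_root (M := M) c) >].
have E x : theta H x = \sum_(c | P x c) code_weight c.
  have [c0 hc0] := code_exists (hM x).
  have P0 : P x c0 by apply/asboolP.
  rewrite (eq_bigr (fun=> theta H x / #|P x|%:R)); last first.
    move=> c /asboolP hc; rewrite /code_weight (theta_iso hc).
    congr (_ / _%:R); apply: eq_card => c'; rewrite !inE.
    apply/asboolP/asboolP => [|hc'].
      exact: rooted_iso_trans.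
    exact: rooted_iso_trans (rooted_iso_sym hc) hc'.
  rewrite sumr_const -[RHS]mulr_natr mulfVK// pnatr_eq0 -lt0n.
  by apply/card_gt0P; exists c0.
rewrite (eq_bigr _ (fun x _ => E x)).
rewrite (exchange_big_dep xpredT)//= mulr_suml; apply: eq_bigr => c _.
by rewrite sumr_const -[code_weight c *+ _]mulr_natl mulrAC.
Qed.

(** Since [f (r + r)] bounds all the balls, one finite list of codes serves every [n], and the
    average is a finite combination of patch frequencies. *)
Lemma theta_cvg (f : nat -> nat) d (T : nat -> finType) (H : forall n, sgraph (T n)) :
  M = f (r + r)%N -> (forall n, growth_le (H n) f) -> weakly_convergent R d H ->
  cvgn (fun n => (\sum_x theta (H n) x) / #|T n|%:R).
Proof.
move=> hM hg [hd _ hcv].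
have rr : (1 <= r + r)%N by rewrite addn_gt0 r1.
rewrite (_ : (fun n => _) = fun n => \sum_c
   patch_freq R (H n) (r + r) (code_graph c) (code_root (M := M) c) * code_weight c); last first.
  by apply: funext => n; apply: theta_average => x; rewrite hM; apply: card_fball.
suff hc (c : code M) : cvgn (fun n =>
    patch_freq R (H n) (r + r) (code_graph c) (code_root c)).
  apply: (cvgP (\sum_c limn (fun n =>
    patch_freq R (H n) (r + r) (code_graph c) (code_root c)) * code_weight c)).
  by apply: cvg_big => [|c _]; [exact: add_continuous|exact: cvgM (hc c) (cvg_cst _)].
(* Weak convergence speaks only of patches; any other code has frequency 0 for every [n]. *)
have [hp|np] := pselect (is_patch (r + r) d (code_graph c) (code_root c)).
  exact: hcv.
rewrite (_ : (fun n => _) = fun=> 0); first exact: is_cvg_cst.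
apply: funext => n; rewrite /patch_freq eq_card0 ?mul0r// => x.
by rewrite !inE; apply/asboolP => iso; apply/np/(rooted_iso_patch iso).
Qed.
End Average.

(** * Convergence of almost additive parameters *)

(** The averages of [theta_sum], divided by [N], converge and are uniformly close to the density of
    [h]. *)
Lemma parameter_cvg (R : realType) (f : nat -> nat) (d : nat) (C : R)
    (h : forall T : finType, sgraph T -> {set T} -> R)
    (T : nat -> finType) (H : forall n, sgraph (T n)) :
  subexponential R f -> induced_invariant h -> 0 <= C ->
  (forall (T : finType) (H : sgraph T), h T H finset.set0 = 0) ->
  (forall (T : finType) (H : sgraph T) S v, max_degree_le H d ->
     h T H S <= h T H (v |: S) <= h T H S + C) ->
  (forall (T : finType) (H : sgraph T) (S S' : {set T}), [disjoint S & S'] ->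
     (forall x y, x \in S -> y \in S' -> ~~ H x y) ->
     h T H (S :|: S') = h T H S + h T H S') ->
  (forall n, growth_le (H n) f) -> weakly_convergent R d H ->
  cvgn (fun n => h (T n) (H n) finset.setT / #|T n|%:R).
Proof.
move=> hf hinv C0 h0 hlip hadd hg hw; apply: cvgn_approx => e e0.
(* The error is [C e / (C + 1) <= e]; dividing by [C + 1] allows [C = 0]. *)
have C1 : 0 < C + 1 by lra.
have [q [r [N [r1 N0 approx]]]] := uniform_approx hf (divr_gt0 e0 C1).
have hd n : max_degree_le (H n) d by case: hw.
have {}approx n := approx _ _ _ _ (hg n) C0 (h0 _ (H n))
  (fun S v => hlip _ (H n) S v (hd n)) (hadd _ (H n)).
have /andP[q0 q1] := (approx 0%N).1.
exists (fun n => (\sum_x theta_sum (H n) (h (T n) (H n)) q r N x) / #|T n|%:R / N%:R).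
  have hv := theta_cvg hinv (N := N) q0 q1 r1 erefl hg hw.
  exact: is_cvgM hv (is_cvg_cst _).
move=> n; have [_ {approx}] := approx n.
set s := \sum_x _; set t := h _ _ _ => hst.
(* On an empty graph both quotients are 0, as the inverse of 0 is 0. *)
have [T0|T0] := posnP #|T n|; first by rewrite T0 invr0 !mulr0 mul0r subrr normr0 ltW.
have TR : 0 < #|T n|%:R :> R by rewrite ltr0n.
have NR : 0 < N%:R :> R by rewrite ltr0n.
have -> : t / #|T n|%:R - s / #|T n|%:R / N%:R =
    - ((s - N%:R * t) / (N%:R * #|T n|%:R)) by field; rewrite !lt0r_neq0.
have NT : 0 < N%:R * #|T n|%:R :> R by rewrite mulr_gt0.
rewrite normrN normrM normfV (gtr0_norm NT).
rewrite ler_pdivrMr//; apply: le_trans hst _.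
rewrite ler_wpM2r ?(ltW NT)// mulrCA ler_piMr ?(ltW e0)// ler_pdivrMr//; lra.
Qed.

(** * Packings of vertices and of edges *)

Section Configurations.
Variables (T E : finType) (supp : E -> {set T}) (item : pred E) (compat : rel E).

(** One notion for independent sets and matchings. Confining the supports to [S] turns the
    parameters into functions of vertex sets. *)
Definition conf (S : {set T}) (X : {set E}) : bool :=
  [forall i in X, item i && (supp i \subset S)] &&
  [forall i in X, forall j in X, (i != j) ==> compat i j].

Lemma confP (S : {set T}) (X : {set E}) : reflect
  ((forall i, i \in X -> item i /\ supp i \subset S) /\
   (forall i j, i \in X -> j \in X -> i != j -> compat i j)) (conf S X).
Proof.
apply: (iffP andP) => -[h1 h2]; split.
- by move=> i iX; have /andP[] := forall_inP h1 i iX.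
- by move=> i j iX jX; apply/implyP; move/forall_inP/(_ _ iX)/forall_inP: h2; apply.
- by apply/forall_inP => i /h1[-> ->].
- by apply/forall_inP => i iX; apply/forall_inP => j jX; apply/implyP/h2.
Qed.

Lemma conf_subset (S S' : {set T}) (X Y : {set E}) : S \subset S' -> Y \subset X ->
  conf S X -> conf S' Y.
Proof.
move=> SS /fintype.subsetP YX /confP[h1 h2]; apply/confP; split.
  by move=> i /YX/h1[? iS]; split=> //; apply: fintype.subset_trans SS.
by move=> i j /YX iX /YX; apply: h2.
Qed.

Lemma conf_set0 S : conf S finset.set0.
Proof. by apply/confP; split=> [i|i j]; rewrite inE. Qed.

Definition conf_max (S : {set T}) : nat := \max_(X | conf S X) #|X|.

Definition conf_sum (R : realType) (lambda : R) (S : {set T}) : R :=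
  \sum_(X | conf S X) lambda ^+ #|X|.

Lemma conf_max_ex S : exists2 X, conf S X & conf_max S = #|X|.
Proof.
have [|X hX eX] := @eq_bigmax_cond _ (conf S) (fun X => #|X|).
  by apply/card_gt0P; exists finset.set0; apply: conf_set0.
by exists X.
Qed.

Lemma conf_max_ge (S : {set T}) (X : {set E}) : conf S X -> (#|X| <= conf_max S)%N.
Proof. by move=> hX; apply: (@bigop.bigmax_sup _ X). Qed.

Lemma conf_sum_ge1 (R : realType) (lambda : R) S : 0 <= lambda ->
  1 <= conf_sum lambda S.
Proof.
move=> l0; rewrite /conf_sum (bigD1 finset.set0) ?conf_set0//= cards0 expr0 lerDl.
by apply: sumr_ge0 => X _; apply: exprn_ge0.
Qed.
End Configurations.

(* The common features of single vertices (independent sets) and of edges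
   (matchings), as objects to be packed in a graph; [supp i] is the set of
   vertices of the object [i]. *)
Record packing (T E : finType) (H : sgraph T) (supp : E -> {set T})
    (item : pred E) (compat : rel E) : Prop := Packing {
  supp_neq0 : forall i, item i -> supp i != finset.set0;
  supp_clique : forall i x y, item i -> x \in supp i -> y \in supp i ->
    x = y \/ H x y;
  compat_meet : forall i j x, item i -> item j -> x \in supp i -> x \in supp j ->
    i != j -> ~~ compat i j;
  compat_far : forall i j, item i -> item j ->
    (forall x y, x \in supp i -> y \in supp j -> x != y /\ ~~ H x y) -> compat i j }.

Section PackingTheory.
Variables (T E : finType) (H : sgraph T) (supp : E -> {set T}).
Variables (item : pred E) (compat : rel E).
Hypothesis hP : packing H supp item compat.
Local Notation conf := (conf supp item compat).
Local Notation conf_max := (conf_max supp item compat).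
Local Notation conf_sum := (conf_sum supp item compat).

Lemma conf_in_set0 (X : {set E}) : conf finset.set0 X -> X = finset.set0.
Proof.
move=> /confP[h1 _]; apply/finset.setP => i; rewrite inE; apply/negP => iX.
have [ii] := h1 _ iX; rewrite finset.subset0 => /eqP s0.
by have := supp_neq0 hP ii; rewrite s0 eqxx.
Qed.

Lemma conf_max0 : conf_max finset.set0 = 0%N.
Proof.
by have [X /conf_in_set0 -> ->] := conf_max_ex supp item compat finset.set0; rewrite cards0.
Qed.

Lemma conf_sum0 (R : realType) (lambda : R) : conf_sum lambda finset.set0 = 1.
Proof.
rewrite /conf_sum (big_pred1 finset.set0) ?cards0 ?expr0// => X.
by apply/idP/eqP => [/conf_in_set0|->]//; apply: conf_set0.
Qed.

Lemma conf_free (S : {set T}) v (X : {set E}) : conf (v |: S) X ->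
  (forall i, i \in X -> v \notin supp i) -> conf S X.
Proof.
move=> /confP[h1 h2] hv; apply/confP; split=> // i iX; have [ii /fintype.subsetP iS] := h1 _ iX.
split=> //; apply/fintype.subsetP => x xi; have := iS _ xi.
by rewrite !inE => /orP[/eqP xv|//]; move: (hv _ iX); rewrite -xv xi.
Qed.

(** Two objects that meet at [v] are incompatible, so [i] is the only member containing [v]. *)
Lemma conf_rem (S : {set T}) v (X : {set E}) i : conf (v |: S) X -> i \in X -> v \in supp i ->
  conf S (X :\ i).
Proof.
move=> hX iX vi; apply: (@conf_free _ v).
  exact: conf_subset (fintype.subxx _) (finset.subsetDl _ _) hX.
move=> j; rewrite !inE => /andP[ji jX]; apply/negP => vj.
have /confP[h1 h2] := hX; have [ii _] := h1 _ iX; have [ij _] := h1 _ jX.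
by have := compat_meet hP ij ii vj vi ji; rewrite h2.
Qed.

Lemma conf_max_lip (S : {set T}) v :
  (conf_max S <= conf_max (v |: S) <= conf_max S + 1)%N.
Proof.
apply/andP; split.
  have [X hX ->] := conf_max_ex supp item compat S; apply: conf_max_ge.
  exact: conf_subset (finset.subsetUr _ _) (fintype.subxx _) hX.
have [X hX ->] := conf_max_ex supp item compat (v |: S).
have [[i /andP[iX vi]]|no] := pselect (exists i, (i \in X) && (v \in supp i)).
  by rewrite (cardsD1 i) iX addnC leq_add2r conf_max_ge// (conf_rem hX).
apply: leq_trans (leq_addr _ _); apply/conf_max_ge/(conf_free hX) => i iX.
by apply/negP => vi; apply: no; exists i; rewrite iX.
Qed.

(** A configuration that is new after adding [v] contains one of the at most [d] objects through
    [v]. Deleting that object is injective, lands in [S] and costs a factor [lambda]. *)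
Lemma conf_sum_lip (R : realType) (lambda : R) (d : nat) (S : {set T}) v : 0 <= lambda ->
  (#|[set i | item i & v \in supp i]| <= d)%N ->
  conf_sum lambda S <= conf_sum lambda (v |: S) <=
    (1 + d%:R * lambda) * conf_sum lambda S.
Proof.
move=> l0 hd; have lX (X : {set E}) : 0 <= lambda ^+ #|X| by rewrite exprn_ge0.
apply/andP; split.
  rewrite /conf_sum [leLHS]big_mkcond [leRHS]big_mkcond /=; apply: ler_sum => X _.
  case: ifPn => [hX|_]; last by case: ifP.
  by rewrite (conf_subset (finset.subsetUr _ _) (fintype.subxx _) hX).
pose I := [set i | item i & v \in supp i].
apply: (@le_trans _ _ (conf_sum lambda S +
    \sum_(i in I) \sum_(X | conf (v |: S) X && (i \in X)) lambda ^+ #|X|)).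
  rewrite {1}/conf_sum (bigID (fun X => conf S X)) /= lerD//.
    rewrite /conf_sum [leLHS]big_mkcond [leRHS]big_mkcond /=; apply: ler_sum => X _.
    by case: (conf S X); rewrite ?andbF// andbT; case: ifP.
  rewrite (exchange_big_dep (conf (v |: S))) /=; last by move=> ? ? _ /andP[].
  rewrite [leLHS]big_mkcond [leRHS]big_mkcond /=; apply: ler_sum => X _.
  case: (boolP (conf (v |: S) X)) => //= hX; case: ifPn => nS; last exact: sumr_ge0.
  have [i /andP[iX vi]] : exists i, (i \in X) && (v \in supp i).
    apply: contrapT => no; move/negP: nS; apply; apply: (conf_free hX) => i iX.
    by apply/negP => vi; apply: no; exists i; rewrite iX.
  have iI : i \in I by rewrite inE vi andbT; have /confP[/(_ _ iX)[]] := hX.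
  by rewrite (bigD1 i) ?iI ?iX//= lerDl sumr_ge0.
rewrite mulrDl mul1r lerD2l.
apply: (@le_trans _ _ (\sum_(i in I) lambda * conf_sum lambda S)); last first.
  rewrite sumr_const -[leLHS]mulr_natl -mulrA ler_wpM2r ?ler_nat//.
  by rewrite mulr_ge0// (le_trans ler01)// conf_sum_ge1.
apply: ler_sum => i; rewrite inE => /andP[ii vi].
rewrite (reindex_onto (fun Y => i |: Y) (fun X => X :\ i)) /=; last first.
  by move=> X /andP[_ iX]; rewrite finset.setD1K.
rewrite /conf_sum mulr_sumr [leLHS]big_mkcond [leRHS]big_mkcond /=.
apply: ler_sum => Y _; case: ifPn => [/andP[/andP[hY iY] /eqP eY]|_]; last first.
  by case: ifP => // _; rewrite mulr_ge0.
have -> : conf S Y by rewrite -eY; apply: conf_rem hY iY vi.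
by rewrite (cardsD1 i) iY eY exprS.
Qed.

Section Additive.
Variables (S S' : {set T}).
Hypotheses (dSS : [disjoint S & S'])
  (far : forall x y, x \in S -> y \in S' -> ~~ H x y).

Lemma conf_disjoint (X X' : {set E}) : conf S X -> conf S' X' -> [disjoint X & X'].
Proof.
move=> /confP[h1 _] /confP[h1' _]; rewrite disjoint_subset; apply/fintype.subsetP => i iX.
rewrite inE; apply/negP => iX'; have [ii iS] := h1 _ iX; have [_ iS'] := h1' _ iX'.
have /finset.set0Pn[x xi] := supp_neq0 hP ii.
have /fintype.subsetP/(_ x (fintype.subsetP iS _ xi)) := etrans (esym (disjoint_subset _ _)) dSS.
by rewrite inE (fintype.subsetP iS').
Qed.

Lemma conf_union (X X' : {set E}) : conf S X -> conf S' X' -> conf (S :|: S') (X :|: X').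
Proof.
move=> /confP[h1 h2] /confP[h1' h2']; apply/confP; split.
  move=> i; rewrite inE => /orP[/h1|/h1'] [ii iS]; split=> //.
    exact: fintype.subset_trans iS (finset.subsetUl _ _).
  exact: fintype.subset_trans iS (finset.subsetUr _ _).
have dxy x y : x \in S -> y \in S' -> x != y.
  move=> xS yS; apply: contraTneq yS => <-.
  have /fintype.subsetP/(_ x xS) := etrans (esym (disjoint_subset _ _)) dSS.
  by rewrite inE.
move=> i j; rewrite !inE => /orP[] iX /orP[] jX ij; first exact: h2.
- have [ii /fintype.subsetP iS] := h1 _ iX; have [jj /fintype.subsetP jS] := h1' _ jX.
  apply: (compat_far hP) => // x y /iS xS /jS yS.
  by rewrite far// dxy.
- have [ii /fintype.subsetP iS] := h1' _ iX; have [jj /fintype.subsetP jS] := h1 _ jX.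
  apply: (compat_far hP) => // x y /iS xS /jS yS.
  by rewrite adj_sym far// eq_sym dxy.
- exact: h2'.
Qed.

Definition conf_part (S0 : {set T}) (X : {set E}) := [set i in X | supp i \subset S0].

Lemma conf_partP (S0 S1 : {set T}) (X : {set E}) : conf S1 X -> conf S0 (conf_part S0 X).
Proof.
move=> /confP[h1 h2]; apply/confP; split=> [i|i j]; rewrite !inE.
  by move=> /andP[/h1[]].
by move=> /andP[iX _] /andP[jX _]; apply: h2.
Qed.

(** The support of an object is a clique, so without edges between [S] and [S'] it lies on one
    side. *)
Lemma conf_partU (X : {set E}) : conf (S :|: S') X -> conf_part S X :|: conf_part S' X = X.
Proof.
move=> /confP[h1 h2]; apply/finset.setP => i; rewrite !inE -andb_orr.
case: (boolP (i \in X)) => //= iX; have [ii /fintype.subsetP iS] := h1 _ iX.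
have [//|/subsetPn[x xi xS]] := boolP (supp i \subset S); rewrite /=.
apply/fintype.subsetP => y yi; have := iS _ yi; have := iS _ xi.
rewrite !inE (negPf xS) /= => xS' /orP[yS|//].
have [xy|xy] := supp_clique hP ii xi yi; first by rewrite -xy in yS; rewrite yS in xS.
by move: (far yS xS'); rewrite adj_sym xy.
Qed.

Lemma conf_partK (X X' : {set E}) : conf S X -> conf S' X' -> conf_part S (X :|: X') = X.
Proof.
move=> hX hX'; have /confP[h1 _] := hX; have /confP[h1' _] := hX'.
apply/finset.setP => i; rewrite !inE; apply/andP/idP => [[/orP[//|iX'] iS]|iX].
  have [ii iS'] := h1' _ iX'; have /finset.set0Pn[x xi] := supp_neq0 hP ii.
  have /fintype.subsetP/(_ x (fintype.subsetP iS _ xi)) := etrans (esym (disjoint_subset _ _)) dSS.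
  by rewrite inE (fintype.subsetP iS').
by rewrite iX; have [_ ->] := h1 _ iX.
Qed.

Lemma conf_maxU : conf_max (S :|: S') = (conf_max S + conf_max S')%N.
Proof.
apply/eqP; rewrite eqn_leq; apply/andP; split.
  have [X hX ->] := conf_max_ex supp item compat (S :|: S').
  rewrite -{1}(conf_partU hX) cardsU; apply: leq_trans (leq_subr _ _) _.
  by apply: leq_add; apply: conf_max_ge; apply: conf_partP hX.
have [X hX ->] := conf_max_ex supp item compat S.
have [X' hX' ->] := conf_max_ex supp item compat S'.
have := conf_disjoint hX hX'; rewrite -finset.setI_eq0 => /eqP d0.
rewrite -[leqLHS]subn0 -(cards0 E) -d0 -cardsU; apply: conf_max_ge.
exact: conf_union.
Qed.
End Additive.

(** Splitting a configuration into its parts in [S] and [S'] is a bijection onto pairs under which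
    sizes add. *)
Lemma conf_sumU (R : realType) (lambda : R) (S S' : {set T}) :
  [disjoint S & S'] -> (forall x y, x \in S -> y \in S' -> ~~ H x y) ->
  conf_sum lambda (S :|: S') = conf_sum lambda S * conf_sum lambda S'.
Proof.
move=> dSS far; rewrite /conf_sum big_distrlr /= pair_big /=.
have dSS' : [disjoint S' & S] by rewrite disjoint_sym.
rewrite (reindex_onto (fun p : {set E} * {set E} => p.1 :|: p.2)
  (fun X => (conf_part S X, conf_part S' X))) /=; last first.
  by move=> X hX; apply: conf_partU hX.
apply: eq_big => [[X X'] /=|[X X'] /= /andP[hX /eqP[e1 e2]]].
  apply/andP/andP => [[hX /eqP[e1 e2]]|[hX hX']].
    by split; [rewrite -e1|rewrite -e2]; apply: conf_partP hX.
  split; first exact: conf_union.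
  by rewrite (conf_partK dSS hX hX') finset.setUC (conf_partK dSS' hX' hX).
have hX1 : conf S X by rewrite -e1; apply: conf_partP hX.
have hX2 : conf S' X' by rewrite -e2; apply: conf_partP hX.
have := conf_disjoint dSS hX1 hX2; rewrite -finset.setI_eq0 => /eqP d0.
by rewrite cardsU d0 cards0 subn0 exprD.
Qed.
End PackingTheory.

Section ConfEmbedding.
Variables (K T EK ET : finType).
Variables (suppK : EK -> {set K}) (itemK : pred EK) (compatK : rel EK).
Variables (suppT : ET -> {set T}) (itemT : pred ET) (compatT : rel ET).
Variables (e : K -> T) (m : EK -> ET).
Hypotheses (einj : injective e) (minj : injective m)
  (mitem : forall i, itemT (m i) = itemK i)
  (msupp : forall i, suppT (m i) = e @: suppK i)
  (mcompat : forall i j, compatT (m i) (m j) = compatK i j)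
  (mlift : forall j, itemT j -> suppT j \subset e @: finset.setT ->
     exists i, m i = j).

Lemma conf_emb (S : {set K}) (X : {set EK}) :
  conf suppT itemT compatT (e @: S) (m @: X) = conf suppK itemK compatK S X.
Proof.
apply/confP/confP => -[h1 h2]; split.
- move=> i iX; have := h1 _ (imset_f m iX); rewrite mitem msupp => -[? /fintype.subsetP sub].
  split=> //; apply/fintype.subsetP => x xi; have /imsetP[y yS /einj ->//] := sub _ (imset_f e xi).
- move=> i j iX jX ij; rewrite -mcompat; apply: h2; rewrite ?imset_f//.
  by apply: contra_neq ij => /minj.
- move=> _ /imsetP[i iX ->]; have [? sub] := h1 _ iX; rewrite mitem msupp.
  by split=> //; apply: finset.imsetS.
- move=> _ _ /imsetP[i iX ->] /imsetP[j jX ->] ij; rewrite mcompat; apply: h2 => //.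
  by apply: contra_neq ij => ->.
Qed.

(** Stated for any commutative monoid so as to serve both the maximum and the sum. *)
Lemma conf_reindex (U : Type) (idx : U) (op : Monoid.com_law idx) (F : nat -> U)
    (S : {set K}) :
  \big[op/idx]_(Y | conf suppT itemT compatT (e @: S) Y) F #|Y| =
  \big[op/idx]_(X | conf suppK itemK compatK S X) F #|X|.
Proof.
rewrite (reindex_onto (fun X : {set EK} => m @: X) (fun Y => m @^-1: Y)) /=.
  apply: eq_big => [X|X _]; last by rewrite card_imset.
  rewrite conf_emb andbC; case: eqP => //= -[]; apply/finset.setP => i.
  by rewrite inE mem_imset.
move=> Y /confP[h1 _]; apply/finset.setP => j; apply/imsetP/idP.
  by move=> [i + ->]; rewrite inE.
move=> jY; have [ij sj] := h1 _ jY.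
have sT := fintype.subset_trans sj (finset.imsetS _ (finset.subsetT _)).
by have [i ij'] := mlift ij sT; exists i; rewrite ?inE ij'.
Qed.
End ConfEmbedding.

(** * Convergence of the packing parameters *)

Section Packing_cvg.
Variables (R : realType) (f : nat -> nat) (d d' : nat).
Variables (E : finType -> finType) (supp : forall T : finType, E T -> {set T})
  (item : forall T : finType, sgraph T -> pred (E T))
  (compat : forall T : finType, sgraph T -> rel (E T))
  (emap : forall K T : finType, (K -> T) -> E K -> E T).
Hypotheses (hpack : forall (T : finType) (H : sgraph T),
    packing H (@supp T) (item H) (compat H))
  (hdeg : forall (T : finType) (H : sgraph T) v, max_degree_le H d ->
    (#|[set i | item H i & v \in supp i]| <= d')%N)
  (hemb : forall (K T : finType) (A : sgraph K) (H : sgraph T) (e : K -> T),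
    injective e -> (forall u v, H (e u) (e v) = A u v) ->
    [/\ injective (emap e), forall i, item H (emap e i) = item A i,
        forall i, supp (emap e i) = e @: supp i,
        forall i j, compat H (emap e i) (emap e j) = compat A i j &
        forall j, item H j -> supp j \subset e @: finset.setT ->
          exists i, emap e i = j]).
Variables (T : nat -> finType) (H : forall n, sgraph (T n)).
Hypotheses (hf : subexponential R f) (hg : forall n, growth_le (H n) f)
  (hw : weakly_convergent R d H).

Lemma conf_max_cvg :
  cvgn (fun n => (conf_max (@supp (T n)) (item (H n)) (compat (H n)) finset.setT)%:R
                 / #|T n|%:R : R).
Proof.
pose h (T : finType) (H : sgraph T) S : R :=
  (conf_max (@supp T) (item H) (compat H) S)%:R.
apply: (@parameter_cvg R f d 1 h) => //.
- move=> K U A B e einj eadj S; congr (_%:R).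
  have [minj h1 h2 h3 h4] := hemb einj eadj.
  exact: (conf_reindex einj minj h1 h2 h3 h4 _ (fun n => n)).
- by move=> U B; rewrite /h (conf_max0 (hpack B)).
- move=> U B S v _; have /andP[l1 l2] := conf_max_lip (hpack B) S v.
  by rewrite /h -(natrD _ _ 1) !ler_nat l1 l2.
- by move=> U B S S' dS far; rewrite /h (conf_maxU (hpack B) dS far) natrD.
Qed.

(** The logarithm makes the multiplicative sum additive, and the factor [1 + d' lambda] per added
    vertex becomes the increment bound. *)
Lemma conf_sum_cvg (lambda : R) : 0 < lambda ->
  cvgn (fun n => ln (conf_sum (@supp (T n)) (item (H n)) (compat (H n)) lambda finset.setT)
                 / #|T n|%:R : R).
Proof.
move=> l0; have l0' := ltW l0.
pose h (T : finType) (H : sgraph T) S : R :=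
  ln (conf_sum (@supp T) (item H) (compat H) lambda S).
have pos (U : finType) (B : sgraph U) S :
    0 < conf_sum (@supp U) (item B) (compat B) lambda S.
  exact: lt_le_trans ltr01 (conf_sum_ge1 _ _ _ _ l0').
have C1 : 1 <= 1 + d'%:R * lambda by rewrite lerDl mulr_ge0.
apply: (@parameter_cvg R f d (ln (1 + d'%:R * lambda)) h) => //.
- move=> K U A B e einj eadj S; congr (ln _).
  have [minj h1 h2 h3 h4] := hemb einj eadj.
  exact: (conf_reindex einj minj h1 h2 h3 h4 _ (fun n => lambda ^+ n)).
- exact: ln_ge0.
- by move=> U B; rewrite /h (conf_sum0 (hpack B)) ln1.
- move=> U B S v hd.
  have /andP[l1 l2] := conf_sum_lip (hpack B) S l0' (hdeg v hd).
  have C0 : 0 < 1 + d'%:R * lambda by lra.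
  by rewrite /h addrC -lnM ?posrE// !ler_ln ?posrE ?mulr_gt0// l1 l2.
- by move=> U B S S' dS far; rewrite /h (conf_sumU (hpack B) _ dS far) lnM ?posrE.
Qed.
End Packing_cvg.

(** * Independent sets and matchings as packings *)

Lemma independent_conf (T : finType) (H : sgraph T) (S : {set T}) :
  independent H S = conf (fun x => [set x]) xpredT (fun x y => ~~ H x y) finset.setT S.
Proof.
apply/idP/confP => [/forall_inP h|[_ h]].
  split=> [x|x y xS yS _]; first by rewrite finset.subsetT.
  by have /forall_inP := h x xS; apply.
apply/forall_inP => x xS; apply/forall_inP => y yS.
(* Independence also tests the pair [x = y], which irreflexivity settles. *)
by have [->|xy] := eqVneq x y; [rewrite adj_irr|apply: h].
Qed.

Lemma matching_conf (T : finType) (H : sgraph T) (M : {set {set T}}) :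
  matching H M = conf id (mem (edges H)) (fun A B : {set T} => [disjoint A & B])
    finset.setT M.
Proof.
apply/andP/confP => [[/fintype.subsetP h1 /finset.trivIsetP h2]|[h1 h2]]; split=> //.
- by move=> A /h1; rewrite finset.subsetT.
- by apply/fintype.subsetP => A /h1[].
- exact/finset.trivIsetP.
Qed.

Lemma edgesP (T : finType) (H : sgraph T) (A : {set T}) :
  reflect (exists x y, H x y /\ A = [set x; y]) (A \in edges H).
Proof.
apply: (iffP imsetP) => [[[x y]]|[x [y [xy ->]]]].
  by rewrite inE /= => xy ->; exists x, y.
by exists (x, y); rewrite ?inE.
Qed.

Lemma packing_vertices (T : finType) (H : sgraph T) :
  packing H (fun x => [set x]) xpredT (fun x y => ~~ H x y).
Proof.
split.
- by move=> x _; apply/finset.set0Pn; exists x; rewrite inE.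
- by move=> i x y _; rewrite !inE => /eqP-> /eqP->; left.
- by move=> i j x _ _; rewrite !inE => /eqP-> /eqP->; rewrite eqxx.
- by move=> x y _ _ /(_ x y); rewrite !inE !eqxx => -[].
Qed.

Lemma packing_edges (T : finType) (H : sgraph T) :
  packing H id (mem (edges H)) (fun A B : {set T} => [disjoint A & B]).
Proof.
split.
- by move=> _ /edgesP[x [y [_ ->]]]; apply/finset.set0Pn; exists x; rewrite !inE eqxx.
- move=> _ u v /edgesP[x [y [xy ->]]]; rewrite !inE.
  by move=> /orP[] /eqP-> /orP[] /eqP->; [left|right|right; rewrite adj_sym|left].
- move=> A B x _ _ xA xB _; apply/negP; rewrite disjoint_subset.
  by move=> /fintype.subsetP/(_ x xA); rewrite inE xB.
- move=> A B _ _ h; rewrite disjoint_subset; apply/fintype.subsetP => x xA.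
  by rewrite inE; apply/negP => xB; have [] := h _ _ xA xB; rewrite eqxx.
Qed.

Lemma card_vertices_at d (T : finType) (H : sgraph T) v : max_degree_le H d ->
  (#|[set i : T | true & v \in [set i]]| <= 1)%N.
Proof.
move=> _; rewrite -(cards1 v); apply/subset_leq_card/fintype.subsetP => i.
by rewrite !inE eq_sym.
Qed.

Lemma card_edges_at d (T : finType) (H : sgraph T) v : max_degree_le H d ->
  (#|[set A | mem (edges H) A & v \in A]| <= d)%N.
Proof.
move=> /(_ v)/card_set_le_I hd; apply: leq_trans hd.
apply: leq_trans (leq_imset_card (fun y => [set v; y]) _).
apply/subset_leq_card/fintype.subsetP => A; rewrite inE => /andP[/edgesP[x [y [xy ->]]]].
rewrite !inE => /orP[] /eqP->; apply/imsetP.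
  by exists y => //; rewrite inE; apply/asboolP.
by exists x; [rewrite inE; apply/asboolP; rewrite /= adj_sym|rewrite finset.setUC].
Qed.

Lemma vertices_emb (K T : finType) (A : sgraph K) (H : sgraph T) (e : K -> T) :
  injective e -> (forall u v, H (e u) (e v) = A u v) ->
  [/\ injective e, forall _ : K, true = true, forall i, [set e i] = e @: [set i],
      forall i j, ~~ H (e i) (e j) = ~~ A i j &
      forall j, true -> [set j] \subset e @: finset.setT -> exists i, e i = j].
Proof.
move=> einj eadj; split=> //.
- by move=> i; rewrite imset_set1.
- by move=> i j; rewrite eadj.
- by move=> j _; rewrite finset.sub1set => /imsetP[i _ ->]; exists i.
Qed.

Lemma edges_emb (K T : finType) (A : sgraph K) (H : sgraph T) (e : K -> T) :
  injective e -> (forall u v, H (e u) (e v) = A u v) ->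
  [/\ injective (fun B : {set K} => e @: B),
      forall B : {set K}, (e @: B \in edges H) = (B \in edges A),
      forall B : {set K}, e @: B = e @: B,
      forall B C : {set K}, [disjoint e @: B & e @: C] = [disjoint B & C] &
      forall B : {set T}, B \in edges H -> B \subset e @: finset.setT ->
        exists C : {set K}, e @: C = B].
Proof.
move=> einj eadj; have iinj := imset_inj einj; split=> //.
- move=> B; apply/edgesP/edgesP => -[x [y [xy hB]]].
    have /imsetP[u _ xu] : x \in e @: B by rewrite hB !inE eqxx.
    have /imsetP[v _ yv] : y \in e @: B by rewrite hB !inE eqxx orbT.
    exists u, v; split; first by rewrite -eadj -xu -yv.
    by apply: iinj; rewrite hB imsetU1 imset_set1 xu yv.
  by exists (e x), (e y); rewrite eadj hB imsetU1 imset_set1.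
- by move=> B C; rewrite imset_disjoint//; apply: in2W.
- move=> B _ /fintype.subsetP sub; exists (e @^-1: B); apply/finset.setP => z.
  apply/imsetP/idP => [[u]|zB]; first by rewrite inE => ? ->.
  by have /imsetP[u _ zu] := sub _ zB; exists u; rewrite ?inE -?zu.
Qed.

(** Paths of the induced subgraph are paths of [G], so its balls embed in those of [G]. *)
Lemma growth_induced (V : choiceType) (G : sgraph V) (F : {fset V}) f :
  growth_le G f -> growth_le (induced_fset G F) f.
Proof.
move=> hg r x r1; apply: card_le_trans (hg r (val x) r1).
have vi : {in gball (induced_fset G F) r x &, injective val} by move=> y z _ _ /val_inj.
rewrite -(card_le_eql (inj_card_eq vi)).
apply: subset_card_le => _ [y xy <-].
by apply: (dist_le_morph (A := induced_fset G F)) xy.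
Qed.

Lemma indep_numberE (T : finType) (H : sgraph T) : indep_number H =
  conf_max (fun x => [set x]) xpredT (fun x y => ~~ H x y) finset.setT.
Proof. by apply: eq_bigl => S; rewrite independent_conf. Qed.

Lemma matching_numberE (T : finType) (H : sgraph T) : matching_number H =
  conf_max id (mem (edges H)) (fun A B : {set T} => [disjoint A & B]) finset.setT.
Proof. by apply: eq_bigl => M; rewrite matching_conf. Qed.

Lemma indep_polyE (R : realType) (lambda : R) (T : finType) (H : sgraph T) :
  indep_poly H lambda =
  conf_sum (fun x => [set x]) xpredT (fun x y => ~~ H x y) lambda finset.setT.
Proof. by apply: eq_bigl => S; rewrite independent_conf. Qed.

Lemma matching_polyE (R : realType) (lambda : R) (T : finType) (H : sgraph T) :
  matching_poly H lambda =
  conf_sum id (mem (edges H)) (fun A B : {set T} => [disjoint A & B]) lambda finset.setT.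
Proof. by apply: eq_bigl => M; rewrite matching_conf. Qed.

(** * The four limits *)

Section Limits.
Variables (R : realType) (f : nat -> nat) (d : nat).
Variables (T : nat -> finType) (H : forall n, sgraph (T n)).
Hypotheses (hf : subexponential R f) (hg : forall n, growth_le (H n) f)
  (hw : weakly_convergent R d H).

Lemma indep_number_cvg : cvgn (fun n => (indep_number (H n))%:R / #|T n|%:R : R).
Proof.
under eq_fun do rewrite indep_numberE.
exact: (conf_max_cvg (E := id) packing_vertices vertices_emb hf hg hw).
Qed.

Lemma matching_number_cvg :
  cvgn (fun n => (matching_number (H n))%:R / #|T n|%:R : R).
Proof.
under eq_fun do rewrite matching_numberE.
exact: (conf_max_cvg (E := fun T => {set T}) packing_edges edges_emb hf hg hw).
Qed.

Lemma indep_poly_cvg (lambda : R) : 0 < lambda ->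
  cvgn (fun n => ln (indep_poly (H n) lambda) / #|T n|%:R : R).
Proof.
move=> l0; under eq_fun do rewrite indep_polyE.
exact: (conf_sum_cvg (E := id) packing_vertices (@card_vertices_at d)
  vertices_emb hf hg hw l0).
Qed.

Lemma matching_poly_cvg (lambda : R) : 0 < lambda ->
  cvgn (fun n => ln (matching_poly (H n) lambda) / #|T n|%:R : R).
Proof.
move=> l0; under eq_fun do rewrite matching_polyE.
exact: (conf_sum_cvg (E := fun T => {set T}) packing_edges (@card_edges_at d)
  edges_emb hf hg hw l0).
Qed.
End Limits.

Local Open Scope classical_set_scope.
Local Open Scope ring_scope.

Theorem theorem5 (R : realType) (f : nat -> nat) (V : choiceType)
    (G : sgraph V) (Gn : nat -> {fset V})
    (hf : subexponential R f)
    (hinf : infinite_set [set: V])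
    (hconn : gconnected G)
    (hgrowth : growth_le G f)
    (hUPF : UPF R G)
    (hGn : folner R G Gn) :
  [/\ cvgn (fun n =>
        (indep_number (induced_fset G (Gn n)))%:R / #|` Gn n|%:R : R),
      cvgn (fun n =>
        (matching_number (induced_fset G (Gn n)))%:R / #|` Gn n|%:R : R),
      forall lambda : R, 0 < lambda -> cvgn (fun n =>
        ln (indep_poly (induced_fset G (Gn n)) lambda) / #|` Gn n|%:R : R) &
      forall lambda : R, 0 < lambda -> cvgn (fun n =>
        ln (matching_poly (induced_fset G (Gn n)) lambda) / #|` Gn n|%:R : R)].
Proof.
(* UPF makes the given Følner sequence weakly convergent. *)
have [d _ /(_ _ hGn) hw] := hUPF.
have hg n : growth_le (induced_fset G (Gn n)) f by apply: growth_induced.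
have cE n : #|` Gn n| = #|Gn n : finType| by rewrite cardfE.
split.
- under eq_fun do rewrite cE; exact: indep_number_cvg hf hg hw.
- under eq_fun do rewrite cE; exact: matching_number_cvg hf hg hw.
- move=> lambda l0; under eq_fun do rewrite cE; exact: (indep_poly_cvg hf hg hw).
- move=> lambda l0; under eq_fun do rewrite cE; exact: (matching_poly_cvg hf hg hw).
Qed.
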